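(* (a) The sequence $\{(2n)!\}_{n=0}^\infty$ is an infinitely divisible Stieltjes moment sequence. (b) For real $c>0$, the power sequence $\{((2n)!)^c\}_{n=0}^\infty$ is Stieltjes determinate if and only if $c\le1$. (c) For each real $c\in(0,1]$, the (unique) measure $\mu_c$ on $[0,\infty)$ with moment sequence $\{((2n)!)^c\}_{n=0}^\infty$ has Mellin transform $\int_0^\infty t^s\,d\mu_c(t)=(\Gamma(2s+1))^c$, $s\ge0$.
   Context: A real sequence $\{m_n\}_{n=0}^\infty$ is a Stieltjes moment sequence if there is a nonnegative measure $\mu$ on $[0,\infty)$ with $m_n=\int_{[0,\infty)}x^n\,d\mu(x)$ for all $n\ge0$; it is Stieltjes determinate if such $\mu$ is unique. A Stieltjes moment sequence $\{m_n\}$ is infinitely divisible (in the sense of Tyan) if $\{m_n^c\}_{n=0}^\infty$ is a Stieltjes moment sequence for every real $c>0$. *)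

(* Defs.v *)
(* MathComp-Analysis *)
From HB Require Import structures.
From mathcomp Require Import all_boot all_order all_algebra.
From mathcomp Require Import all_classical all_reals all_analysis.

Set Implicit Arguments.
Unset Strict Implicit.
Unset Printing Implicit Defensive.

Import Order.TTheory GRing.Theory Num.Theory.
Import numFieldNormedType.Exports.

Local Open Scope classical_set_scope.
Local Open Scope ring_scope.

(* A measure on [0, +oo[ is represented by a Borel measure on the line that
   gives no mass to the negative half-line.  The moment integrals are extended
   real valued, so the equations below also assert that they are finite. *)
Definition stieltjes_represents (R : realType)
    (mu : {measure set (measurableTypeR R) -> \bar R}) (m : nat -> R) : Prop :=
  mu [set x : R | x < 0] = 0%E /\
  forall n : nat, (\int[mu]_(x in `[0%R, +oo[) (x ^+ n)%:E)%E = (m n)%:E.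

Definition stieltjes_moment_sequence (R : realType) (m : nat -> R) : Prop :=
  exists mu : {measure set (measurableTypeR R) -> \bar R},
    stieltjes_represents mu m.

(* Measures are compared on Borel sets only: the values of a library measure
   on non-measurable sets are unconstrained. *)
Definition stieltjes_determinate (R : realType) (m : nat -> R) : Prop :=
  stieltjes_moment_sequence m /\
  forall mu nu : {measure set (measurableTypeR R) -> \bar R},
    stieltjes_represents mu m -> stieltjes_represents nu m ->
    forall A : set (measurableTypeR R), measurable A -> mu A = nu A.

Definition infinitely_divisible_stieltjes (R : realType) (m : nat -> R) : Prop :=
  stieltjes_moment_sequence m /\
  forall c : R, 0 < c -> stieltjes_moment_sequence (fun n => m n `^ c).

(* Since 0 `^ 0 = 1, an atom of mu at 0 counts for s = 0 and only then. *)
Definition mellin_transform (R : realType)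
    (mu : {measure set (measurableTypeR R) -> \bar R}) (s : R) : \bar R :=
  (\int[mu]_(t in `[0%R, +oo[) (t `^ s)%:E)%E.

(* Euler's integral, meaningful for x > 0. *)
Definition Gamma (R : realType) (x : R) : R :=
  \int[@lebesgue_measure R]_(t in `]0, +oo[) (t `^ (x - 1) * expR (- t)).

(* Main.v *)
(* Call phi a Mellin function when phi s = E (X ^ s) for some nonnegative random
   variable X and all s >= 0.  Mellin functions are stable under products
   (independent variables), mixtures and, by Helly selection applied to quantile
   functions, pointwise limits.  For a <= b the ratio a (b + s) / (b (a + s)) is a
   mixture of 1 and a / (a + s), and 1 + e (r - 1) approximates r ^ e for r near
   1, so a subdivision of [a, b] makes every power 0 <= e <= 1 of the ratio a
   Mellin function.  Gauss's product then shows that Gamma (2 s + 1) ^ c is one.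

   Uniqueness for c <= 1: when m_n <= (2 n)!, the moments determine the integral
   of cos (t sqrt x) for all t, by Taylor steps of length at most 1/4 starting at
   t = 0.  Polynomials in cos (h sqrt x) approximate the indicators of the sets
   cos (h sqrt x) < cos (h a), and h -> 0 gives the tails x > a ^ 2.

   Non-uniqueness for c > 1: pick a rational r with 1 < r < c, and put b = 2 r and
   t = pi / b, so 0 < t < pi / 2.  With respect to
     v ^ (b - 1) exp (- v cos t) (1 + sin (v sin t)) dv,
   the sine does not contribute to the moments of order b n of v, because the
   integral of v ^ p exp (- v cos t) sin (v sin t) is Gamma (p + 1) sin ((p + 1) t).
   Multiply by a variable with Mellin function
   Gamma (2 s + 1) ^ r / Gamma (b + b s), up to normalization, which exists because
   the poles of its Gauss product interlace, and by one with
   Gamma (2 s + 1) ^ (c - r): the result agrees with Gamma (2 s + 1) ^ c at the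
   integers but not at s = 1 / 2. *)
Require Import Defs.
From HB Require Import structures.
From mathcomp Require Import all_boot all_order all_algebra.
From mathcomp Require Import all_classical all_reals all_analysis.
From mathcomp Require Import measurable_realfun ring lra.

Set Implicit Arguments.
Unset Strict Implicit.
Unset Printing Implicit Defensive.

Import Order.TTheory GRing.Theory Num.Theory.
Import numFieldNormedType.Exports.

Local Open Scope classical_set_scope.
Local Open Scope ring_scope.

(** * Quantiles and Helly selection *)

(** Existence has to cope with fractional powers: independence produces only integer ones. The
    infinite divisibility of the logarithm of a gamma variable is therefore obtained pole by pole,
    and limits of laws do the rest. All laws are transported to one uniform variable, so that a
    limit of laws becomes a pointwise limit off a countable set, within reach of Fatou's lemma.

    The threshold [c = 1] is visible in Taylor's formula for [cos (t sqrt x)]. The remainder of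
    order [J] is at most [h ^ J / J!] times the integral of [(sqrt x) ^ J], and moments below
    [(2 n)!] keep that integral below [2 (J + 1)!]. Hence a step [h] of fixed length works at every
    [t]; with [c > 1] the same bound would diverge for every [h > 0].

    For [c > 1] the sine perturbation needs [t < pi / 2] to keep exponential decay, that is [b > 2]
    and [r > 1]. A rational [r = p / q] lets every pole and zero be cut into pieces of the same
    multiplicity [1 / q], which can be matched one to one; the surplus [c - r] takes care of
    irrational [c]. *)

(** The rays []a, +oo[] and the whole line form a generating pi-system; the line is added because it
    is the exhausting set of finite measure. A ray with [a < 0] has full mass, so only [a >= 0] has
    to be compared. *)
Lemma measure_eq_tails (R : realType) (mu nu : {measure set (measurableTypeR R) -> \bar R}) :
  mu [set x : R | x < 0] = 0%E -> nu [set x : R | x < 0] = 0%E ->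
  (mu setT < +oo)%E -> mu setT = nu setT ->
  (forall a : R, 0 <= a -> mu `]a, +oo[%classic = nu `]a, +oo[%classic) ->
  forall A : set (measurableTypeR R), measurable A -> mu A = nu A.
Proof.
move=> mu0 nu0 muoo muT mn.
have tail (xi : {measure set (measurableTypeR R) -> \bar R}) (a : R) :
    xi [set x : R | x < 0] = 0%E -> a < 0 ->
    xi `]a, +oo[%classic = xi setT.
  move=> xi0 a0.
  have N0 : xi (~` `]a, +oo[%classic) = 0%E.
    apply: (subset_measure0 _ _ _ xi0) => //.
    - by apply: measurableC; exact: measurable_itv.
    - by rewrite -[X in measurable X]set_itvE; exact: measurable_itv.
    - by move=> x /=; rewrite in_itv/= andbT => /negP; rewrite -leNgt => /le_lt_trans; exact.
  rewrite -(setUv `]a, +oo[%classic) measureU ?setICr//.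
  - by rewrite [X in (_ + X)%E](_ : _ = 0%E) ?adde0.
  - by apply: measurableC; exact: measurable_itv.
have H := @measure_unique _ R (measurableTypeR R)
  (@RGenOInfty.G R `|` [set setT] : set (set (measurableTypeR R)))
  (fun=> setT) _ _ _ _ mu nu.
apply: H.
- rewrite RGenOInfty.measurableE eqEsubset; split.
    by apply: sub_smallest2r; [exact: smallest_sigma_algebra | move=> A ?; left].
  apply: smallest_sub; first exact: smallest_sigma_algebra.
  move=> A [GA|->]; first exact: sub_sigma_algebra.
  exact: (@measurableT _ (g_sigma_algebraType (@RGenOInfty.G R))).
- move=> A B [[a ->]|->] [[b ->]|->]; rewrite ?setIT ?setTI.
  + left; exists (Num.max a b); rewrite predeqE => x /=.
    by rewrite !in_itv/= !andbT gt_max; split=> [[-> ->]|/andP[]].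
  + by left; exists a.
  + by left; exists b.
  + by right.
- by move=> _; right.
- by rewrite bigcup_const//; exists 0%N.
- move=> A [[a ->]|->//]; have [/mn//|a0] := leP 0 a.
  by rewrite !tail.
- by [].
Qed.

Section unit_law.
Context (R : realType).

(** The uniform law, as a measure on the whole line. It is the common probability space on which all
    laws are realized by quantile functions. *)
Definition unit_law : set (measurableTypeR R) -> \bar R :=
  mrestr (@lebesgue_measure R) (measurable_itv `]0%R, 1%R[).

HB.instance Definition _ := Measure.on unit_law.

Let unit_lawT : unit_law setT = 1%E.
Proof. by rewrite /unit_law /mrestr setTI lebesgue_measure_itv/= lte_fin ltr01 oppr0 addr0. Qed.

HB.instance Definition _ := Measure_isProbability.Build _ _ _ unit_law unit_lawT.

Lemma unit_law_tail (a : R) : 0 <= a <= 1 ->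
  unit_law `]a, +oo[%classic = (1 - a)%:E.
Proof.
move=> /andP[a0 a1]; rewrite /unit_law /mrestr.
rewrite (_ : _ `&` _ = `]a, 1[%classic); last first.
  apply/seteqP; split=> x /=; rewrite !in_itv/= andbT.
    by move=> [-> /andP[]].
  by move=> /andP[ax ->]; rewrite ax (le_lt_trans a0).
rewrite lebesgue_measure_itv/= lte_fin; have [//|] := ltP a 1.
by move=> ?; rewrite (_ : a = 1) ?subrr//; apply/eqP; rewrite eq_le a1.
Qed.

End unit_law.
Arguments unit_law R : clear implicits.

Section quantile.
Context (R : realType) d (T : measurableType d) (P : probability T R).
Context (X : {RV P >-> R}) (X0 : forall w, 0 <= X w).

(** The value 0 off []0, 1[] is a default on a null set for [unit_law]; it keeps the function
    nonnegative everywhere. *)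
Definition quantile (u : R) : R :=
  if u \in `]0, 1[ then inf [set t | u%:E <= cdf X t]%E else 0.

Let cdf_neg (t : R) : t < 0 -> cdf X t = 0%E.
Proof.
move=> t0; rewrite /cdf /distribution /pushforward.
rewrite [X in P X](_ : _ = set0) ?measure0//.
apply/seteqP; split=> w //=; rewrite in_itv/= => /le_lt_trans/(_ t0).
by rewrite ltNge X0.
Qed.

Let cdf_ge_ge0 (u t : R) : 0 < u -> (u%:E <= cdf X t)%E -> 0 <= t.
Proof.
move=> u0; apply: contraTT; rewrite -ltNge => /cdf_neg ->.
by rewrite lee_fin -ltNge.
Qed.

Let has_inf_quantile (u : R) : u \in `]0, 1[ ->
  has_inf [set t | u%:E <= cdf X t]%E.
Proof.
rewrite in_itv/= => /andP[u0 u1]; split; last first.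
  by exists 0 => t /=; exact: cdf_ge_ge0.
apply: contrapT => /forallNP cdfu.
have : (1 <= u%:E)%E.
  apply: (cvge_le _ (@cvg_cdfy1 _ _ _ P X)); apply: nearW => t.
  by rewrite leNgt; apply/negP => /ltW; exact: cdfu.
by rewrite lee_fin leNgt u1.
Qed.

Lemma quantile_ge0 (u : R) : 0 <= quantile u.
Proof.
rewrite /quantile; case: ifPn => // u01.
apply: lb_le_inf; first by have [] := has_inf_quantile u01.
by move=> t /=; apply: cdf_ge_ge0; move: u01; rewrite in_itv/= => /andP[].
Qed.

(** Right continuity of the distribution function makes the infimum attained. The resulting Galois
    connection gives the monotonicity, the measurability and the law of [quantile]. *)
Lemma quantile_le (u t : R) : u \in `]0, 1[ ->
  (quantile u <= t) = (u%:E <= cdf X t)%E.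
Proof.
move=> u01; rewrite /quantile u01; apply/idP/idP; last first.
  by move=> ut; apply: ge_inf => //; have [] := has_inf_quantile u01.
move=> qt; apply: (cvge_ge _ (@cdf_right_continuous _ _ _ P X t)).
near=> t'.
have tt' : t < t' by near: t'; exact: nbhs_right_gt.
have [||s us st'] := @inf_adherent _ [set t | u%:E <= cdf X t]%E (t' - t).
- by rewrite subr_gt0.
- exact: has_inf_quantile.
apply: (le_trans us); apply: cdf_nondecreasing.
by apply/ltW/(lt_le_trans st'); lra.
Unshelve. all: by end_near. Qed.

Lemma quantile_homo : {in `]0, 1[ &, {homo quantile : u v / u <= v}}.
Proof.
move=> u v u01 v01 uv; rewrite quantile_le//.
apply: (@le_trans _ _ v%:E); first by rewrite lee_fin.
by rewrite -quantile_le.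
Qed.

Let quantile_gt (t : R) : 0 <= t ->
  [set u | t < quantile u] = `]fine (cdf X t), 1[%classic.
Proof.
move=> t0; have cf : cdf X t \is a fin_num by rewrite fin_num_measure.
apply/seteqP; split=> u /=.
  rewrite ltNge; case: (boolP (u \in `]0, 1[)) => u01.
    rewrite quantile_le// -ltNge -[X in (X < _)%E]fineK// lte_fin in_itv/= => ->.
    by move: u01; rewrite in_itv/= => /andP[].
  by rewrite /quantile (negbTE u01) t0.
rewrite in_itv/= => /andP[cu u1].
have u01 : u \in `]0, 1[.
  by rewrite in_itv/= u1 andbT (le_lt_trans _ cu)// fine_ge0// cdf_ge0.
by rewrite ltNge quantile_le// -ltNge -[X in (X < _)%E]fineK// lte_fin.
Qed.

Lemma measurable_quantile :
  measurable_fun [set: measurableTypeR R] (quantile : measurableTypeR R -> R).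
Proof.
apply: (measurability (@RGenOInfty.G R)).
  exact: RGenOInfty.measurableE.
move=> _ [_ [t ->] <-]; rewrite setTI.
have [t0|t0] := leP 0 t.
  have -> : quantile @^-1` `]t, +oo[ = [set u | t < quantile u].
    by apply/seteqP; split=> u /=; rewrite in_itv/= andbT.
  by rewrite quantile_gt.
have -> : quantile @^-1` `]t, +oo[ = setT; last exact: measurableT.
apply/seteqP; split=> u //= _; rewrite in_itv/= andbT.
exact: lt_le_trans (quantile_ge0 u).
Qed.

Let mquantile : measurable_fun [set: measurableTypeR R]
    (quantile : measurableTypeR R -> measurableTypeR R).
Proof. exact: measurable_quantile. Qed.

Let mX : measurable_fun [set: T] (X : T -> measurableTypeR R).
Proof. have mX : measurable_fun [set: T] (X : T -> R) by exact: measurable_funPT.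
exact: mX. Qed.

Let quantile_mfun : {mfun measurableTypeR R >-> measurableTypeR R} :=
  HB.pack (quantile : measurableTypeR R -> measurableTypeR R)
    (isMeasurableFun.Build _ _ _ _ _ mquantile).

Let X_mfun : {mfun T >-> measurableTypeR R} :=
  HB.pack (X : T -> measurableTypeR R) (isMeasurableFun.Build _ _ _ _ _ mX).

(** Both laws have the tails [1 - cdf X a] for [a >= 0], so [measure_eq_tails] identifies them. *)
Lemma quantile_law (f : R -> \bar R) : measurable_fun [set: R] f ->
  (forall x, 0 <= f x)%E ->
  (\int[unit_law R]_u f (quantile u) = \int[P]_w f (X w))%E.
Proof.
move=> mf f0.
transitivity (\int[distribution (unit_law R) quantile_mfun]_x f x)%E.
  by rewrite ge0_integral_distribution.
transitivity (\int[distribution P X_mfun]_x f x)%E; last first.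
  by rewrite ge0_integral_distribution.
have neg0 d' (T' : measurableType d') (P' : probability T' R) (Y : {RV P' >-> measurableTypeR R}) :
    (forall w, 0 <= (Y w : R)) -> distribution P' Y [set x : R | x < 0] = 0%E.
  move=> Y0; rewrite /distribution /pushforward.
  rewrite [X in P' X](_ : _ = set0) ?measure0//.
  by apply/seteqP; split=> w //=; rewrite ltNge Y0.
apply: eq_measure_integral => A mA _.
apply: (@measure_eq_tails R (distribution (unit_law R) quantile_mfun) (distribution P X_mfun)) => //.
- exact/neg0/quantile_ge0.
- exact: neg0.
- by rewrite /distribution/= /pushforward preimage_setT probability_setT ltry.
- by rewrite /distribution/= /pushforward !preimage_setT !probability_setT.
move=> a a0.
transitivity (1 - cdf X a)%E.
  have cf : cdf X a \is a fin_num by rewrite fin_num_measure.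
  have ca1 : 0 <= fine (cdf X a) <= 1.
    by rewrite fine_ge0 ?cdf_ge0//= -lee_fin fineK// cdf_le1.
  rewrite /distribution /pushforward/=.
  have -> : quantile @^-1` `]a, +oo[ = [set u | a < quantile u].
    by apply/seteqP; split=> u /=; rewrite in_itv/= andbT.
  rewrite quantile_gt// -[in RHS](fineK cf) -EFinB -unit_law_tail//.
  rewrite /unit_law /mrestr; congr (lebesgue_measure _).
  apply/seteqP; split=> u /=; rewrite !in_itv/= ?andbT.
    by move=> [/andP[-> ->]].
  by move=> [-> /andP[-> ->]].
by rewrite -ccdf_1_cdf.
Qed.

End quantile.

Lemma diagonal_subsequence (R : realType) (u : nat -> nat -> R) :
  (forall k, bounded_fun (u k)) ->
  exists2 f : nat -> nat, (forall n, (n <= f n)%N) & forall k, cvgn (u k \o f).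
Proof.
move=> bu.
have /choice[tau /all_and2[tau_id tau_cvg]] : forall p : nat * (nat -> nat),
    exists t : nat -> nat,
      (forall n, (n <= t n)%N) /\ cvgn (u p.1 \o p.2 \o t).
  move=> [k g].
  have [|t ti tc] := @bolzano_weierstrass R (u k \o g).
    have [M [Mr HM]] := bu k.
    by exists M; split=> // x Mx n _; exact: HM.
  exists t; split=> //; elim=> [//|n ih].
  by apply: (leq_ltn_trans ih); move/increasing_seqP : ti; exact.
pose F := fix F n := if n is m.+1 then F m \o tau (m, F m) else id.
(* Each later stage is an earlier one reindexed by some [g] with [n <= g n]. Such a reindexing
   preserves limits at infinity, so strict monotonicity need not be tracked. *)
have FD k j : exists2 g : nat -> nat, (forall n, (n <= g n)%N) & F (k + j)%N = F k \o g.
  elim: j => [|j [g g_id Fg]]; first by exists id => //; rewrite addn0.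
  exists (g \o tau ((k + j)%N, F (k + j)%N)).
    by move=> n; exact: (leq_trans (tau_id _ n) (g_id _)).
  by rewrite addnS [LHS]/= {1}Fg.
exists (fun n => F n n).
  by move=> n; have [g g_id] := FD 0 n; rewrite add0n => ->; exact: g_id.
move=> k; have /= /cvg_ex[l Hl] := tau_cvg (k, F k).
apply/cvg_ex; exists l => A /Hl[N _ HN].
exists (maxn N k.+1) => // n /=; rewrite geq_max => /andP[Nn kn].
have [g g_id Fg] := FD k.+1 (n - k.+1)%N.
rewrite -(subnKC kn) Fg (subnKC kn) /=.
by apply: HN => /=; rewrite (leq_trans Nn).
Qed.

(** Monotonicity carries convergence from the rationals to every point at which the limit on the
    rationals has no jump. *)
Lemma helly_selection (R : realType) (Q : nat -> R -> R) :
  (forall n, {in `]0, 1[ &, {homo Q n : u v / u <= v}}) ->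
  (forall u : R, u \in `]0, 1[ -> bounded_fun (Q ^~ u)) ->
  exists2 f : nat -> nat, (forall n, (n <= f n)%N) &
  exists2 N : set R, countable N &
    forall u : R, u \in `]0, 1[ -> ~ N u -> cvgn (fun n => Q (f n) u).
Proof.
move=> ndQ bQ.
pose q k : R := ratr (odflt 0 (unpickle k)).
have [|f f_id fcvg] := @diagonal_subsequence R
    (fun k n => if q k \in `]0, 1[ then Q n (q k) else 0).
  move=> k; case: (boolP (q k \in `]0, 1[)) => [|_]; first exact: bQ.
  by exists 0; split=> // x x0 n _ /=; rewrite normr0 ltW.
exists f => //.
have Qcvg (r : rat) : (ratr r : R) \in `]0, 1[ -> cvgn (fun n => Q (f n) (ratr r)).
  move=> r01; have := fcvg (pickle r).
  by rewrite /q pickleK/= r01.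
pose L (r : rat) := lim ((fun n => Q (f n) (ratr r)) @ \oo).
(* The points at which [L] jumps across the level [r]. There is at most one: at a rational between
   two of them [L] would be both above and below [r]. Rational levels catch every jump, so the
   exceptional set is countable. *)
pose S (r : R) := [set u : R | [/\ u \in `]0, 1[,
  (forall p : rat, (ratr p : R) \in `]0, u[ -> L p < r) &
  (forall p : rat, (ratr p : R) \in `]u, 1[ -> r < L p)]].
exists (\bigcup_(r : rat) S (ratr r)).
  apply: bigcup_countable => // r _.
  have [->|/set0P[x Sx]] := eqVneq (S (ratr r)) set0; first exact: countable0.
  suff -> : S (ratr r) = [set x] by exact: countable1.
  apply/seteqP; split=> y /=; last by move=> ->.
  have H (a b : R) : S (ratr r) a -> S (ratr r) b -> ~ a < b.
    move=> [a01 _ ar] [b01 br _] /rat_in_itvoo[p pab].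
    move: a01 b01 pab; rewrite !in_itv/= => /andP[a0 a1] /andP[b0 b1] /andP[ap pb].
    have := ar p; rewrite in_itv/= ap (lt_trans pb)// => /(_ isT).
    have := br p; rewrite in_itv/= pb (lt_trans a0)// => /(_ isT).
    by move=> /lt_trans /[apply]; rewrite ltxx.
  move=> Sy; apply/eqP; rewrite eq_le !leNgt; apply/andP; split; apply/negP; exact: H.
move=> u u01 NSu; move: (u01); rewrite in_itv/= => /andP[u0 u1].
have [p0 p0u] : exists p : rat, (ratr p : R) \in `]0, u[ := rat_in_itvoo u0.
have [p1 p1u] : exists p : rat, (ratr p : R) \in `]u, 1[ := rat_in_itvoo u1.
have sub0 (p : rat) : (ratr p : R) \in `]0, u[ -> (ratr p : R) \in `]0, 1[.
  by rewrite !in_itv/= => /andP[-> /lt_trans -> //].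
have sub1 (p : rat) : (ratr p : R) \in `]u, 1[ -> (ratr p : R) \in `]0, 1[.
  by rewrite !in_itv/= => /andP[/(lt_trans u0) -> ->].
have Lub (p p' : rat) : (ratr p : R) \in `]0, u[ -> (ratr p' : R) \in `]u, 1[ ->
    L p <= L p'.
  move=> pu pu'; apply: ler_lim; [exact/Qcvg/sub0|exact/Qcvg/sub1|].
  apply: nearW => n; apply: ndQ; [exact: sub0|exact: sub1|].
  move: pu pu'; rewrite !in_itv/= => /andP[_ pu] /andP[up' _].
  exact/ltW/(lt_trans pu).
pose A := [set L p | p in [set p : rat | (ratr p : R) \in `]0, u[]].
have supA : has_sup A.
  split; first by exists (L p0), p0.
  by exists (L p1) => _ [p pu <-]; exact: Lub.
apply/cvg_ex; exists (sup A); apply/cvgrPdist_lt => e e0.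
have [_ [p pu <-] Lp] := sup_adherent e0 supA.
have [|r] := @rat_in_itvoo R (sup A) (sup A + e); first by rewrite ltrDl.
rewrite in_itv/= => /andP[Ar re].
(* Otherwise [L] exceeds [r] at all rationals to the right of [u], while to the left it is at most
   [sup A < r], and [u] would be a jump across [r]. *)
have [p' p'u Lp'] : exists2 p' : rat, (ratr p' : R) \in `]u, 1[ & L p' <= ratr r.
  apply: contrapT => /forall2NP H; apply: NSu; exists r => //; split=> //.
    move=> s su; apply: (le_lt_trans _ Ar); apply: ub_le_sup; first by case: supA.
    by exists s.
  by move=> s su; have [//|/negP] := H s; rewrite -ltNge.
have /Qcvg cp := sub0 _ pu; have /Qcvg cp' := sub1 _ p'u.
near=> n.
have h1 : Q (f n) (ratr p) <= Q (f n) u.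
  by apply: ndQ => //; [exact: sub0|move: pu; rewrite /= in_itv/= => /andP[_ /ltW]].
have h2 : Q (f n) u <= Q (f n) (ratr p').
  by apply: ndQ => //; [exact: sub1|move: p'u; rewrite in_itv/= => /andP[/ltW]].
have h3 : sup A - e < Q (f n) (ratr p) by near: n; exact: (cvgr_gt (L p)).
have h4 : Q (f n) (ratr p') < sup A + e.
  by near: n; apply: (cvgr_lt (L p')) => //; exact: le_lt_trans re.
by rewrite ltr_norml; apply/andP; split; lra.
Unshelve. all: by end_near. Qed.

(** * Convergence of moments *)

(** For [l > 0] the power is differentiable at [l]. At [l = 0] with [s > 0] the bound is direct: a
    value below the power [1 / s] of [e] has its power [s] below [e]. *)
Lemma cvg_powR_base (R : realType) (T : Type) (F : set_system T)
    (FF : ProperFilter F) (u : T -> R) (l s : R) : 0 <= s ->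
  (\forall t \near F, 0 <= u t) -> u t @[t --> F] --> l ->
  u t `^ s @[t --> F] --> l `^ s.
Proof.
rewrite le_eqVlt => /predU1P[<-|s0] u0 ul.
  by under eq_fun do rewrite powRr0; rewrite powRr0; exact: cvg_cst.
have l0 : 0 <= l by exact: (cvgr_to_ge ul).
move: l0; rewrite le_eqVlt => /predU1P[l0|l0]; last first.
  apply: (cvg_comp _ (fun x : R => x `^ s) ul).
  have l0' : l \in `]0, +oo[ by rewrite in_itv/= l0.
  have /derivable1_diffP := @derivable_powR R 1 s _ l0'.
  exact: differentiable_continuous.
rewrite -l0 powR0 ?gt_eqF//; apply/cvgrPdist_lt => e e0.
have e1 : 0 < e `^ s^-1 by exact: powR_gt0.
move: ul; rewrite -l0 => /cvgrPdist_lt/(_ _ e1); apply: filterS2 u0 => t ut0.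
rewrite !sub0r !normrN ger0_norm// ger0_norm ?powR_ge0// => ut.
rewrite -[ltRHS](@powRr1 _ e) ?ltW// -(@mulVf _ s) ?gt_eqF// powRrM.
by apply: gt0_ltr_powR; rewrite ?nnegrE// ltW.
Qed.

Lemma powR_within_continuous (R : realType) (p : R) : 0 <= p ->
  {within `[0, +oo[, continuous (fun x : R => x `^ p)}.
Proof.
move=> p0; apply/subspace_continuousP => x; rewrite /= in_itv/= andbT => x0.
apply: cvg_powR_base => //.
- apply: within_nbhs_proper; apply: subset_closure.
  by rewrite /= in_itv/= x0.
- by apply: filterS (withinT _ _) => y; rewrite /= in_itv/= andbT.
- exact: cvg_within.
Qed.

Lemma measurable_fun_powR (R : realType) d (T : measurableType d) (D : set T)
  (f : T -> R) (r : R) :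
  measurable_fun D f -> measurable_fun D (fun w => f w `^ r).
Proof. exact: (measurableT_comp (measurable_powR r)). Qed.

Lemma fatou_cvg (R : realType) d (T : measurableType d)
    (mu : {measure set T -> \bar R}) (f : nat -> T -> R) (g : T -> R)
    (a : nat -> R) (l : R) :
  (forall n, measurable_fun setT (f n)) -> (forall n w, 0 <= f n w) ->
  (forall w, f n w @[n --> \oo] --> g w) ->
  (forall n, \int[mu]_w (f n w)%:E = (a n)%:E)%E ->
  a n @[n --> \oo] --> l -> (\int[mu]_w (g w)%:E <= l%:E)%E.
Proof.
move=> mf f0 fg fa al.
have := @fatou _ T R mu setT measurableT (fun n w => (f n w)%:E) _ _.
have -> : (\int[mu]_w limn_einf (fun n => (f n w)%:E) = \int[mu]_w (g w)%:E)%E.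
  apply: eq_integral => w _; apply: (cvg_limn_einf_sup _).1.
  by apply: cvg_EFin; [exact: nearW|exact: fg].
under [X in limn_einf X]eq_fun do rewrite fa.
have -> : limn_einf (EFin \o a) = l%:E.
  by apply: (cvg_limn_einf_sup _).1; apply: cvg_EFin; [exact: nearW|].
apply; first by move=> n; exact/measurable_EFinP.
by move=> n w _; rewrite lee_fin.
Qed.

Section moments.
Context (R : realType) d (T : measurableType d) (P : probability T R).

(** The integrand is the square [e (W ^ s - 1 / (2 e)) ^ 2], hence nonnegative. Adding back the
    integral of [W ^ s] leaves only sums of nonnegative functions, with no extended real difference
    to split. *)
Lemma integral_square_gap (W : T -> R) (s a b e : R) : 0 < e ->
  measurable_fun setT W -> (forall w, 0 <= W w) ->
  (\int[P]_w (W w `^ s)%:E = a%:E)%E ->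
  (\int[P]_w (W w `^ (s * 2))%:E = b%:E)%E ->
  (\int[P]_w (e * W w `^ (s * 2) + (4 * e)^-1 - W w `^ s)%:E =
    (e * b + (4 * e)^-1 - a)%:E)%E.
Proof.
move=> e0 mW W0 Wa Wb.
have mp r : measurable_fun setT (fun w => W w `^ r).
  exact: measurable_fun_powR.
have gap0 w : 0 <= e * W w `^ (s * 2) + (4 * e)^-1 - W w `^ s.
  rewrite powRrM powR_mulrn ?powR_ge0//.
  have -> : e * W w `^ s ^+ 2 + (4 * e)^-1 - W w `^ s =
    e * (W w `^ s - (2 * e)^-1) ^+ 2 by field; rewrite gt_eqF.
  by rewrite mulr_ge0 ?sqr_ge0// ltW.
have mgap : measurable_fun setT (fun w => e * W w `^ (s * 2) + (4 * e)^-1 - W w `^ s).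
  by apply: measurable_funB => //; apply: measurable_funD => //; exact: measurable_funM.
have : (\int[P]_w (e * W w `^ (s * 2) + (4 * e)^-1 - W w `^ s)%:E +
        \int[P]_w (W w `^ s)%:E = (e * b + (4 * e)^-1)%:E)%E.
  rewrite -ge0_integralD//; last 4 first.
  - by move=> w _; rewrite lee_fin.
  - exact/measurable_EFinP.
  - by move=> w _; rewrite lee_fin powR_ge0.
  - exact/measurable_EFinP.
  under eq_integral do rewrite -EFinD subrK EFinD EFinM.
  rewrite ge0_integralD//; last 3 first.
  - by move=> w _; rewrite -EFinM lee_fin mulr_ge0 ?powR_ge0// ltW.
  - by apply/measurable_EFinP; exact: measurable_funM.
  - by move=> w _; rewrite lee_fin invr_ge0 mulr_ge0// ltW.
  rewrite ge0_integralZl//; last 3 first.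
  - exact/measurable_EFinP.
  - by move=> w _; rewrite lee_fin powR_ge0.
  - by rewrite lee_fin ltW.
  rewrite Wb integral_cst// EFinD EFinM; congr (_ + _)%E.
  by rewrite -[RHS]mule1; congr (_ * _)%E; exact: probability_setT.
rewrite Wa.
by case: (\int[P]_w _)%E => [r| |]//=; rewrite -EFinD => -[<-]; rewrite addrK.
Qed.

(* Fatou bounds the limit moment from above; applied to the nonnegative
   function [e Y^(2s) + 1/(4e) - Y^s] it bounds it from below. *)
Lemma moment_cvg (Y : nat -> T -> R) (Z : T -> R) (phi_ : nat -> R -> R)
    (phi : R -> R) :
  (forall n, measurable_fun setT (Y n)) -> (forall n w, 0 <= Y n w) ->
  measurable_fun setT Z -> (forall w, Y n w @[n --> \oo] --> Z w) ->
  (forall n s, 0 <= s -> (\int[P]_w (Y n w `^ s)%:E = (phi_ n s)%:E)%E) ->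
  (forall s, 0 <= s -> phi_ n s @[n --> \oo] --> phi s) ->
  forall s, 0 <= s -> (\int[P]_w (Z w `^ s)%:E = (phi s)%:E)%E.
Proof.
move=> mY Y0 mZ YZ Yphi phic.
have Z0 w : 0 <= Z w by apply: (cvgr_to_ge (YZ w)); exact: nearW.
have mp n r : measurable_fun setT (fun w => Y n w `^ r).
  exact: measurable_fun_powR.
have up s : 0 <= s -> (\int[P]_w (Z w `^ s)%:E <= (phi s)%:E)%E.
  move=> s0; apply: (@fatou_cvg _ _ _ _ (fun n w => Y n w `^ s) _ (phi_ ^~ s)) => //.
  - by move=> n w; exact: powR_ge0.
  - by move=> w; apply: cvg_powR_base => //; exact: nearW.
  - by move=> n; exact: Yphi.
  - exact: phic.
have fin s : 0 <= s -> exists2 a : R, 0 <= a & (\int[P]_w (Z w `^ s)%:E = a%:E)%E.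
  move=> /up Zs; have : (0 <= \int[P]_w (Z w `^ s)%:E)%E.
    by apply: integral_ge0 => w _; rewrite lee_fin powR_ge0.
  by move: Zs; case: (\int[P]_w _)%E => [r| |]// _ r0; exists r.
move=> s s0; have s20 : 0 <= s * 2 by rewrite mulr_ge0.
have [a a0 Za] := fin s s0; have [b b0 Zb] := fin _ s20.
have phi0 : 0 <= phi (s * 2) by rewrite (le_trans b0)// -lee_fin -Zb up.
apply/eqP; rewrite eq_le up//= Za lee_fin.
rewrite leNgt; apply/negP => aphi.
(* Chosen so that [e * phi (2 s) < phi s - a]. Fatou yields [phi s - a <= e * phi (2 s) - e * b], a
   contradiction because [e * b >= 0]. *)
pose e := (phi s - a) / (phi (s * 2) + 1).
have p1 : 0 < phi (s * 2) + 1 by rewrite ltr_wpDl.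
have e0 : 0 < e by rewrite divr_gt0// subr_gt0.
have gap0 n w : 0 <= e * Y n w `^ (s * 2) + (4 * e)^-1 - Y n w `^ s.
  rewrite powRrM powR_mulrn ?powR_ge0//.
  have -> : e * Y n w `^ s ^+ 2 + (4 * e)^-1 - Y n w `^ s =
    e * (Y n w `^ s - (2 * e)^-1) ^+ 2 by field; rewrite gt_eqF.
  by rewrite mulr_ge0 ?sqr_ge0// ltW.
have := @fatou_cvg _ _ _ P
  (fun n w => e * Y n w `^ (s * 2) + (4 * e)^-1 - Y n w `^ s)
  (fun w => e * Z w `^ (s * 2) + (4 * e)^-1 - Z w `^ s)
  (fun n => e * phi_ n (s * 2) + (4 * e)^-1 - phi_ n s)
  (e * phi (s * 2) + (4 * e)^-1 - phi s) _ gap0 _ _ _.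
rewrite (integral_square_gap e0 mZ Z0 Za Zb) lee_fin => H.
have : e * b + (4 * e)^-1 - a <= e * phi (s * 2) + (4 * e)^-1 - phi s.
  apply: H.
  - move=> n; apply: measurable_funB => //; apply: measurable_funD => //.
    exact: measurable_funM.
  - move=> w; apply: cvgB; last by apply: cvg_powR_base => //; exact: nearW.
    by apply: cvgD; [apply: cvgMr; apply: cvg_powR_base => //; exact: nearW|exact: cvg_cst].
  - by move=> n; apply: integral_square_gap => //; exact: Yphi.
  - apply: cvgB; last exact: phic.
    by apply: cvgD; [apply: cvgMr; exact: phic|exact: cvg_cst].
have eb : 0 <= e * b by rewrite mulr_ge0// ltW.
have : e * phi (s * 2) < phi s - a.
  rewrite /e mulrAC ltr_pdivrMr// ltr_pM2l ?subr_gt0//; lra.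
lra.
Qed.

End moments.

(** * Mellin functions *)

(** The space is left arbitrary so that products and mixtures can live on product spaces;
    [mellin_fun_quantile] brings them back to [unit_law]. *)
Definition mellin_fun (R : realType) (phi : R -> R) : Prop :=
  exists d (T : measurableType d) (P : probability T R) (X : T -> R),
    [/\ measurable_fun setT X, forall w, 0 <= X w &
     forall s, 0 <= s -> (\int[P]_w (X w `^ s)%:E = (phi s)%:E)%E].

Lemma mellin_fun_quantile (R : realType) (phi : R -> R) : mellin_fun phi ->
  exists Q : R -> R, [/\
    measurable_fun [set: measurableTypeR R] (Q : measurableTypeR R -> R),
    forall u, 0 <= Q u,
    {in `]0, 1[ &, {homo Q : u v / u <= v}} &
    forall s, 0 <= s -> (\int[unit_law R]_u (Q u `^ s)%:E = (phi s)%:E)%E].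
Proof.
move=> [d [T [P [X [mX X0 Xphi]]]]].
pose Xm : {mfun T >-> R} := HB.pack X (isMeasurableFun.Build _ _ _ _ _ mX).
exists (@quantile _ _ _ P Xm); split.
- exact: measurable_quantile.
- exact: quantile_ge0.
- exact: quantile_homo.
- move=> s s0; rewrite (@quantile_law _ _ _ _ Xm X0 (fun x => (x `^ s)%:E)).
  + exact: Xphi.
  + by apply/measurable_EFinP; exact: measurable_powR.
  + by move=> x; rewrite lee_fin powR_ge0.
Qed.

(** Markov's inequality on []u, 1[], where [Q] is at least [Q u]. It turns bounded first moments
    into the pointwise bounds required by Helly selection. *)
Lemma monotone_markov (R : realType) (Q : R -> R) (a u : R) :
  measurable_fun [set: measurableTypeR R] (Q : measurableTypeR R -> R) ->
  (forall u, 0 <= Q u) -> {in `]0, 1[ &, {homo Q : u v / u <= v}} ->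
  (\int[unit_law R]_u (Q u)%:E = a%:E)%E -> u \in `]0, 1[ ->
  Q u <= a / (1 - u).
Proof.
move=> mQ Q0 ndQ Qa u01; move: (u01); rewrite in_itv/= => /andP[u0 u1].
pose I : set (measurableTypeR R) := `]u, 1[%classic.
have mI : measurable I by exact: measurable_itv.
have PI : unit_law R I = (1 - u)%:E.
  rewrite /unit_law /mrestr setIidl; last first.
    by move=> x; rewrite /I/= !in_itv/= => /andP[/(lt_trans u0) -> ->].
  by rewrite lebesgue_measure_itv/= lte_fin u1.
have mQE (A : set (measurableTypeR R)) : measurable A ->
    measurable_fun A (fun x : measurableTypeR R => (Q x)%:E).
  by move=> mA; apply/measurable_EFinP; exact: measurable_funTS.
have H1 : (\int[unit_law R]_(x in I) (Q x)%:E <= \int[unit_law R]_x (Q x)%:E)%E.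
  apply: ge0_subset_integral => //; first exact: mQE.
  by move=> x _; rewrite lee_fin.
have H2 : (\int[unit_law R]_(x in I) (Q u)%:E <= \int[unit_law R]_(x in I) (Q x)%:E)%E.
  apply: ge0_le_integral => //.
  - by move=> x _; rewrite lee_fin.
  - exact: mQE.
  - move=> x; rewrite /I/= in_itv/= => /andP[ux x1]; rewrite lee_fin.
    by apply: ndQ => //; [rewrite in_itv/= x1 (lt_trans u0)|exact: ltW].
have IQ : (\int[unit_law R]_(x in I) (Q u)%:E = (Q u * (1 - u))%:E)%E.
  by rewrite integral_cst// EFinM; congr (_ * _)%E; exact: PI.
have := le_trans H2 H1; rewrite IQ Qa lee_fin.
by rewrite ler_pdivlMr ?subr_gt0.
Qed.

Lemma unit_law_co_null (R : realType) (N : set R) : countable N ->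
  unit_law R (~` (`]0, 1[%classic `\` N)) = 0%E.
Proof.
move=> cN; have N0 : lebesgue_measure N = 0%E := countable_lebesgue_measure0 cN.
have mN : measurable (N : set (measurableTypeR R)) by exact: countable_measurable.
apply/eqP; rewrite eq_le measure_ge0 andbT -N0 /unit_law /mrestr.
apply: le_measure; rewrite ?inE//.
  apply: measurableI; last exact: measurable_itv.
  by apply: measurableC; apply: measurableD => //; exact: measurable_itv.
by move=> x [+ x01] => /not_andP[//|/contrapT].
Qed.

Lemma mellin_fun_lim (R : realType) (phi_ : nat -> R -> R) (phi : R -> R) :
  (forall n, mellin_fun (phi_ n)) ->
  (forall s, 0 <= s -> phi_ n s @[n --> \oo] --> phi s) -> mellin_fun phi.
Proof.
move=> Mphi phic.
have /choice[Q HQ] := fun n => mellin_fun_quantile (Mphi n).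
have [||f f_id [N cN Qcvg]] := @helly_selection R Q.
- by move=> n; have [] := HQ n.
- move=> u u01; have u1 : 0 < 1 - u.
    by move: u01; rewrite in_itv/= subr_gt0 => /andP[].
  have [M [Mr HM]] : bounded_fun (phi_ ^~ 1).
    by apply: cvg_seq_bounded; apply/cvg_ex; exists (phi 1); exact: phic.
  exists (Num.max M 0 / (1 - u)); split; first exact: num_real.
  move=> x Mx n _ /=; have [mQ Q0 ndQ Qphi] := HQ n.
  rewrite ger0_norm//; apply: (le_trans (monotone_markov (a := phi_ n 1) mQ Q0 ndQ _ u01)).
    rewrite -Qphi//; apply: eq_integral => v _.
    by rewrite powRr1.
  rewrite ler_pdivrMr//; move: Mx; rewrite ltr_pdivrMr// gt_max => /andP[Mx x0].
  by apply: (le_trans (ler_norm _)); exact: HM.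
pose D := `]0, 1[%classic `\` N : set (measurableTypeR R).
have mD : measurable D.
  by apply: measurableD; [exact: measurable_itv|exact: countable_measurable].
(* Setting the functions to 0 on the null complement of [D] makes them converge everywhere and
   leaves their moments unchanged. *)
pose Y n : measurableTypeR R -> R := (Q (f n)) \_ D.
pose Z (w : measurableTypeR R) : R := lim (Y n w @[n --> \oo]).
have mY n : measurable_fun setT (Y n).
  apply/(measurable_restrictT _ mD); apply: measurable_funTS.
  by have [] := HQ (f n).
have Y0 n w : 0 <= Y n w.
  by rewrite /Y patchE; case: ifPn => // _; have [] := HQ (f n).
have YZ w : Y n w @[n --> \oo] --> Z w.
  have [Dw|Dw] := boolP (w \in D).
    rewrite /Z /Y; under eq_fun do rewrite patchE Dw.
    by move: Dw; rewrite inE => -[w01 Nw]; exact: Qcvg.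
  rewrite /Z /Y; under eq_fun do rewrite patchE (negbTE Dw).
  exact: is_cvg_cst.
have mZ : measurable_fun setT Z.
  by apply: (@measurable_fun_cvg _ _ _ _ Y) => // w _; exact: YZ.
have Z0 w : 0 <= Z w by apply: (cvgr_to_ge (YZ w)); exact: nearW.
exists _, (measurableTypeR R), (unit_law R), Z; split=> //.
apply: (@moment_cvg _ _ _ (unit_law R) Y Z (fun n => phi_ (f n))) => //.
  move=> n s s0; have [mQ Q0 ndQ Qphi] := HQ (f n).
  rewrite -(Qphi s s0); apply: ge0_ae_eq_integral; first exact: measurableT.
  - by apply/measurable_EFinP; exact: measurable_fun_powR.
  - by apply/measurable_EFinP; exact: measurable_fun_powR.
  - by move=> w _; rewrite lee_fin powR_ge0.
  - by move=> w _; rewrite lee_fin powR_ge0.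
  exists (~` D); split; [exact: measurableC|exact: unit_law_co_null|].
  move=> w /= Hw Dw; apply: Hw => _; rewrite /Y patchE.
  by have -> : w \in D by rewrite inE.
move=> s s0 A /(phic s s0)[K _ HK]; exists K => // n /= Kn.
by apply: HK => /=; exact: leq_trans (f_id n).
Qed.

Lemma mellin_fun_measure (R : realType) (phi : R -> R) : mellin_fun phi ->
  exists mu : {measure set (measurableTypeR R) -> \bar R},
    mu [set x : R | x < 0] = 0%E /\
    forall s, 0 <= s -> mellin_transform mu s = (phi s)%:E.
Proof.
move=> [d [T [P [X [mX X0 Xphi]]]]].
pose Xm : {mfun T >-> measurableTypeR R} := HB.pack (X : T -> measurableTypeR R)
  (isMeasurableFun.Build _ _ T (measurableTypeR R) (X : T -> measurableTypeR R) mX).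
exists (distribution P Xm); split.
  have XE : X @^-1` [set x : R | x < 0] = set0.
    by apply/seteqP; split=> w //=; rewrite ltNge X0.
  transitivity (P (X @^-1` [set x : R | x < 0])) => //.
  by rewrite XE measure0.
move=> s s0; rewrite /mellin_transform -Xphi//.
transitivity (\int[pushforward P Xm]_(t in `[0%R, +oo[) (t `^ s)%:E)%E => //.
rewrite ge0_integral_pushforward.
- have -> : Xm @^-1` `[0, +oo[ = setT by apply/seteqP; split=> w //= _; rewrite in_itv/= X0.
  by [].
- exact: mX.
- exact: measurable_itv.
- by apply/measurable_EFinP; apply: measurable_funTS; exact: measurable_powR.
- by move=> x _; rewrite lee_fin powR_ge0.
Qed.

Lemma unit_law_integral (R : realType) (f : R -> R) :
  measurable_fun [set: R] f -> (forall x, 0 <= f x) ->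
  (\int[unit_law R]_x (f x)%:E = \int[lebesgue_measure]_(x in `]0%R, 1%R[) (f x)%:E)%E.
Proof.
move=> mf f0.
pose I : set (measurableTypeR R) := `]0, 1[%classic.
have mI : measurable I by exact: measurable_itv.
rewrite (@ge0_negligible_integral _ _ _ _ setT (~` I))//; last 4 first.
- exact: measurableC.
- by apply/measurable_EFinP; exact: mf.
- by move=> x _; rewrite lee_fin.
- have := @unit_law_co_null R set0 (@countable0 _); rewrite setD0; exact.
rewrite setTD setCK.
apply: eq_measure_integral => A mA AI.
by rewrite /= /unit_law /mrestr setIidl.
Qed.

Lemma mellin_fun_pow (R : realType) (a : R) : 0 <= a -> mellin_fun (powR a).
Proof.
move=> a0; exists _, (measurableTypeR R), (unit_law R), (cst a); split=> //.
move=> s s0; rewrite /= integral_cst// -[RHS]mule1.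
by congr (_ * _)%E; exact: probability_setT.
Qed.

Lemma mellin_funM (R : realType) (phi psi : R -> R) :
  mellin_fun phi -> mellin_fun psi -> mellin_fun (fun s => phi s * psi s).
Proof.
move=> [d1 [T1 [P1 [X1 [mX1 X10 X1phi]]]]] [d2 [T2 [P2 [X2 [mX2 X20 X2psi]]]]].
have mX : measurable_fun setT (fun w : T1 * T2 => X1 w.1 * X2 w.2).
  apply: measurable_funM; first exact: (measurableT_comp mX1).
  exact: (measurableT_comp mX2).
exists _, (T1 * T2)%type, (P1 \x P2)%E, (fun w => X1 w.1 * X2 w.2); split=> //.
  by move=> w; rewrite mulr_ge0.
move=> s s0; rewrite fubini_tonelli1; last 2 first.
- by apply/measurable_EFinP; exact: measurable_fun_powR.
- by move=> w; rewrite lee_fin powR_ge0.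
rewrite /fubini_F/=.
under eq_integral => x _.
  under eq_integral do rewrite powRM// EFinM.
  rewrite ge0_integralZl//; last 3 first.
  - by apply/measurable_EFinP; exact: measurable_fun_powR.
  - by move=> w _; rewrite lee_fin powR_ge0.
  - by rewrite lee_fin powR_ge0.
  rewrite X2psi//.
  over.
rewrite /= ge0_integralZr//.
- by rewrite X1phi// EFinM.
- by apply/measurable_EFinP; exact: measurable_fun_powR.
- by move=> w _; rewrite lee_fin powR_ge0.
- rewrite -X2psi//; apply: integral_ge0 => w _; by rewrite lee_fin powR_ge0.
Qed.

Lemma integral_powR01 (R : realType) (p : R) : 0 <= p ->
  (\int[lebesgue_measure]_(x in `]0%R, 1%R[) (x `^ p)%:E = ((p + 1)^-1)%:E)%E.
Proof.
move=> p0; have p1 : 0 < p + 1 by rewrite ltr_wpDl.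
have mf : measurable_fun [set: measurableTypeR R] (fun x : R => x `^ p).
  exact: measurable_powR.
rewrite -(@integral_itv_bndoo _ 0 1 _ true false); last first.
  by apply/measurable_EFinP; exact: measurable_funTS.
rewrite (@continuous_FTC2 _ _ (fun x => (p + 1)^-1 * x `^ (p + 1)))//.
- by rewrite powR1 powR0 ?gt_eqF// mulr1 mulr0 sube0.
- apply: continuous_subspaceW (powR_within_continuous p0).
  by apply: subset_itvl.
- split.
  + move=> x; rewrite in_itv/= => /andP[x0 _].
    apply: derivableM => //; apply: derivable_powR; by rewrite in_itv/= x0.
  + apply: cvgMr; apply: cvg_powR_base; first exact: ltW.
    * near=> x; near: x; exact: nbhs_right_ge.
    * exact: cvg_at_right_filter.
  + apply: cvgMr; apply: cvg_powR_base; first exact: ltW.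
    * near=> x; near: x; exact: nbhs_left_ge.
    * exact: cvg_at_left_filter.
- move=> x; rewrite in_itv/= => /andP[x0 _].
  rewrite derive1Ml; last by apply: derivable_powR; rewrite in_itv/= x0.
  rewrite powR_derive1; last by rewrite in_itv/= x0.
  by rewrite addrK mulrA mulVf ?mul1r// gt_eqF.
Unshelve. all: by end_near. Qed.

(** The variable is [U ^ (1 / a)] for a uniform [U], which has the beta law with parameters [a] and
    1. *)
Lemma mellin_fun_beta (R : realType) (a : R) : 0 < a ->
  mellin_fun (fun s => a / (a + s)).
Proof.
move=> a0; exists _, (measurableTypeR R), (unit_law R), (fun u : R => u `^ a^-1).
split=> [|u|s s0].
- exact: measurable_powR.
- exact: powR_ge0.
rewrite (@unit_law_integral _ (fun u => (u `^ a^-1) `^ s)); last 2 first.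
- by apply: measurable_fun_powR; exact: measurable_powR.
- by move=> x; exact: powR_ge0.
under eq_integral do rewrite -powRrM.
rewrite integral_powR01 ?mulr_ge0 ?invr_ge0// ?ltW//.
by congr (_%:E); field; rewrite !gt_eqF// ltr_wpDr.
Qed.

Lemma mellin_fun_mix (R : realType) (p : R) (phi psi : R -> R) : 0 <= p <= 1 ->
  mellin_fun phi -> mellin_fun psi ->
  mellin_fun (fun s => p * phi s + (1 - p) * psi s).
Proof.
move=> /andP[p0 p1] /mellin_fun_quantile[Q1 [mQ1 Q10 _ Q1phi]].
move=> /mellin_fun_quantile[Q2 [mQ2 Q20 _ Q2psi]].
(* The second uniform coordinate serves as an independent coin with success probability [p]. *)
pose X (w : measurableTypeR R * measurableTypeR R) : R :=
  if w.2 < p then Q1 w.1 else Q2 w.1.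
have mX : measurable_fun setT X.
  apply: measurable_fun_ifT.
  - by apply: measurable_fun_ltr => //; exact: measurable_snd.
  - exact: (measurableT_comp mQ1).
  - exact: (measurableT_comp mQ2).
have q0 : 0 <= 1 - p by rewrite subr_ge0.
exists _, (measurableTypeR R * measurableTypeR R)%type, (unit_law R \x unit_law R)%E, X.
split=> // [w|s s0]; first by rewrite /X; case: ifP.
rewrite fubini_tonelli2; last 2 first.
- by apply/measurable_EFinP; exact: measurable_fun_powR.
- by move=> w; rewrite lee_fin powR_ge0.
have phi0 : 0 <= phi s.
  by rewrite -lee_fin -Q1phi//; apply: integral_ge0 => w _; rewrite lee_fin powR_ge0.
have psi0 : 0 <= psi s.
  by rewrite -lee_fin -Q2psi//; apply: integral_ge0 => w _; rewrite lee_fin powR_ge0.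
pose I : set (measurableTypeR R) := `]-oo, p[%classic.
have mI : measurable I by exact: measurable_itv.
have PI : unit_law R I = p%:E.
  rewrite /unit_law /mrestr (_ : I `&` _ = `]0, p[%classic); last first.
    apply/seteqP; split=> x; rewrite /I/= !in_itv/=; first by move=> [-> /andP[->]].
    by move=> /andP[-> xp]; rewrite xp (lt_le_trans xp).
  rewrite lebesgue_measure_itv/= lte_fin; case: ltP => // p0'.
    by rewrite oppr0 adde0.
  by congr (_%:E); apply/eqP; rewrite eq_le p0 p0'.
transitivity (\int[unit_law R]_(y in I `|` ~` I)
    (if y < p then phi s else psi s)%:E)%E.
  rewrite setUv; apply: eq_integral => y _; rewrite /fubini_G/= /X/=.
  by case: ifP => _; [rewrite -Q1phi|rewrite -Q2psi].
have mif : measurable_fun setT (fun y : measurableTypeR R => if y < p then phi s else psi s).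
  by apply: measurable_fun_ifT => //; exact: measurable_fun_ltr.
rewrite ge0_integral_setU//; last 4 first.
- exact: measurableC.
- by rewrite setUv; exact/measurable_EFinP.
- by move=> y _; rewrite lee_fin; case: ifP.
- exact/disj_setPCl.
rewrite EFinD; congr (_ + _)%E.
  transitivity (\int[unit_law R]_(y in I) (phi s)%:E)%E.
    by apply: eq_integral => y; rewrite inE /I/= in_itv/= => ->.
  by rewrite integral_cst// EFinM muleC; congr (_ * _)%E; exact: PI.
transitivity (\int[unit_law R]_(y in ~` I) (psi s)%:E)%E.
  apply: eq_integral => y; rewrite inE /I/= in_itv/= => /negP/negbTE.
  by move=> ->.
rewrite integral_cst//; last exact: measurableC.
rewrite EFinM muleC; congr (_ * _)%E.
have PC : unit_law R (~` I) = (1 - p)%:E.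
  by rewrite EFinB -PI; exact: (probability_setC (unit_law R) mI).
exact: PC.
Qed.

(** With [L = ln u], the tangent of the exponential at [e L] is compared with it at [L] and at 0. In
    the average with weights [e] and [1 - e] the linear terms cancel. *)
Lemma bernoulli_powR (R : realType) (e u : R) : 0 <= e <= 1 -> 0 < u ->
  u `^ e <= 1 + e * (u - 1).
Proof.
move=> /andP[e0 e1] u0; rewrite /powR gt_eqF//.
have uE : u = expR (ln u) by rewrite lnK.
rewrite [in leRHS]uE; set L := ln u; have em := expR_gt0 (e * L).
have h1 : expR (e * L) * (1 + (L - e * L)) <= expR L.
  have -> : expR L = expR (e * L) * expR (L - e * L).
    by rewrite -expRD addrC subrK.
  by rewrite ler_pM2l// expR_ge1Dx.
have h0 : expR (e * L) * (1 - e * L) <= 1.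
  by rewrite -[leRHS](expRxMexpNx_1 (e * L)) ler_pM2l// expR_ge1Dx.
have e1' : 0 <= 1 - e by rewrite subr_ge0.
have := lerD (ler_wpM2l e0 h1) (ler_wpM2l e1' h0).
lra.
Qed.

Lemma eq_mellin_fun (R : realType) (phi psi : R -> R) :
  (forall s, 0 <= s -> phi s = psi s) -> mellin_fun phi -> mellin_fun psi.
Proof.
move=> pp [d [T [P [X [mX X0 Xphi]]]]]; exists d, T, P, X; split=> // s s0.
by rewrite -pp// Xphi.
Qed.

Lemma mellin_fun1 (R : realType) : mellin_fun (fun=> 1 : R).
Proof.
apply: eq_mellin_fun (@mellin_fun_pow R 1 ler01) => s _.
by rewrite powR1.
Qed.

Lemma mellin_fun_prod (R : realType) (phi_ : nat -> R -> R) n :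
  (forall i, (i < n)%N -> mellin_fun (phi_ i)) ->
  mellin_fun (fun s => \prod_(i < n) phi_ i s).
Proof.
elim: n => [_|n ih H].
  by apply: eq_mellin_fun (mellin_fun1 R) => s _; rewrite big_ord0.
apply: (@eq_mellin_fun _ (fun s => (\prod_(i < n) phi_ i s) * phi_ n s)).
  by move=> s _; rewrite big_ord_recr.
by apply: mellin_funM; [apply: ih => i /ltnW; exact: H|exact: H].
Qed.

(** * Fractional powers of pole ratios *)

Definition pole_ratio (R : realType) (a b s : R) : R :=
  a * (b + s) / (b * (a + s)).

Section pole_ratio.
Context (R : realType).
Implicit Types a b c s e : R.

Lemma pole_ratio_gt0 a b s : 0 < a -> 0 < b -> 0 <= s -> 0 < pole_ratio a b s.
Proof. by move=> a0 b0 s0; rewrite divr_gt0 ?mulr_gt0// ltr_wpDr. Qed.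

Lemma pole_ratioM a b c s : 0 < a -> 0 < b -> 0 < c -> 0 <= s ->
  pole_ratio a b s * pole_ratio b c s = pole_ratio a c s.
Proof.
move=> a0 b0 c0 s0; rewrite /pole_ratio; field.
by rewrite !gt_eqF// ltr_wpDr.
Qed.

Lemma mellin_fun_pole_mix a b e : 0 < a -> a <= b -> 0 <= e <= 1 ->
  mellin_fun (fun s => 1 + e * (pole_ratio a b s - 1)).
Proof.
move=> a0 ab /andP[e0 e1]; have b0 : 0 < b := lt_le_trans a0 ab.
(* The ratio is the mixture of [a / (a + s)] and 1 with weights [1 - a / b] and [a / b]; passing
   from [r] to [1 + e (r - 1)] multiplies the first weight by [e]. *)
have p01 : 0 <= e * (1 - a / b) <= 1.
  have ab1 : a / b <= 1 by rewrite ler_pdivrMr// mul1r.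
  have ab0 : 0 <= a / b by rewrite divr_ge0// ltW.
  by apply/andP; split; nra.
apply: eq_mellin_fun (mellin_fun_mix p01 (mellin_fun_beta a0) (mellin_fun1 R)).
move=> s s0; rewrite /pole_ratio; field.
by rewrite !gt_eqF// ltr_wpDr.
Qed.

Lemma pole_ratio_le1 a b s : 0 < a -> a <= b -> 0 <= s -> pole_ratio a b s <= 1.
Proof.
move=> a0 ab s0; have b0 : 0 < b := lt_le_trans a0 ab.
rewrite /pole_ratio ler_pdivrMr ?mulr_gt0// ?ltr_wpDr// mul1r; nra.
Qed.

Lemma pole_ratio_ge a b s : 0 < a -> a <= b -> 0 <= s -> a / b <= pole_ratio a b s.
Proof.
move=> a0 ab s0; have b0 : 0 < b := lt_le_trans a0 ab.
rewrite /pole_ratio ler_pdivlMr ?mulr_gt0// ?ltr_wpDr//.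
have -> : a / b * (b * (a + s)) = a * (a + s) by field; rewrite gt_eqF.
by rewrite ler_pM2l// lerD2r.
Qed.

(** Bernoulli for [r] is the lower bound, Bernoulli for [1 / r] the upper one: the product of the
    two linear expressions is [1 + e (1 - e) (1 - r) ^ 2 / r], an error of second order in
    [1 - r]. *)
Lemma pole_mix_bounds a b e r : 0 < a -> a <= b -> 0 <= e <= 1 ->
  a / b <= r <= 1 ->
  r `^ e <= 1 + e * (r - 1) <= r `^ e * (1 + b / a * ((b - a) / b) ^+ 2).
Proof.
move=> a0 ab e01 /andP[r1 r2]; have b0 : 0 < b := lt_le_trans a0 ab.
have r0 : 0 < r by apply: lt_le_trans r1; rewrite divr_gt0.
apply/andP; split; first exact: bernoulli_powR.
have rV : r^-1 `^ e <= 1 + e * (r^-1 - 1) by apply: bernoulli_powR; rewrite ?invr_gt0.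
have re : r `^ e * r^-1 `^ e = 1.
  by rewrite -powRM ?invr_ge0 ?ltW// divff ?gt_eqF// powR1.
have re0 : 0 < r `^ e by rewrite powR_gt0.
have r1V : r^-1 <= b / a by rewrite -[leRHS]invrK invf_div lef_pV2 ?posrE// divr_gt0.
have rV1 : 1 <= r^-1 by rewrite invf_ge1.
move: e01 => /andP[e0 e1].
have y0 : 0 <= 1 + e * (r - 1) by nra.
have -> : 1 + e * (r - 1) = r `^ e * (r^-1 `^ e * (1 + e * (r - 1))).
  by rewrite mulrA re mul1r.
rewrite ler_pM2l//; apply: (le_trans (ler_wpM2r y0 rV)).
have -> : (1 + e * (r^-1 - 1)) * (1 + e * (r - 1)) =
    1 + e * (1 - e) * (r^-1 * (1 - r) ^+ 2) by field; rewrite gt_eqF.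
rewrite lerD2l.
have ba : (b - a) / b = 1 - a / b by field; rewrite gt_eqF.
apply: (@le_trans _ _ (r^-1 * (1 - r) ^+ 2)).
  have : 0 <= r^-1 * (1 - r) ^+ 2 by rewrite mulr_ge0 ?sqr_ge0// invr_ge0 ltW.
  have : 0 <= e * (1 - e) <= 1 by apply/andP; split; nra.
  move: (e * (1 - e)) (_ * _ ^+ 2) => p q; nra.
apply: ler_pM => //; rewrite ?sqr_ge0 ?invr_ge0 ?(ltW r0)//.
by rewrite ba ler_sqr ?nnegrE ?subr_ge0 ?(le_trans r1)// lerD2l lerN2.
Qed.

End pole_ratio.

(* The factor [1 + e (r - 1)] approximates [r ^ e] to second order in [r - 1];
   subdividing [a, b] into n pieces leaves a total error of order 1/n. *)
Lemma mellin_fun_pole_pow (R : realType) (a b e : R) : 0 < a -> a <= b ->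
  0 <= e <= 1 -> mellin_fun (fun s => pole_ratio a b s `^ e).
Proof.
move=> a0 ab e01; have b0 : 0 < b := lt_le_trans a0 ab.
have ba0 : 0 <= b - a by rewrite subr_ge0.
pose h n : R := (b - a) / n.+1%:R.
pose x n i : R := a + i%:R * h n.
have h0 n : 0 <= h n by rewrite divr_ge0.
have xa n i : a <= x n i by rewrite lerDl mulr_ge0.
have xS n i : x n i.+1 = x n i + h n by rewrite /x -natr1; ring.
have xx n i : x n i <= x n i.+1 by rewrite xS lerDl.
have x0 n i : 0 < x n i := lt_le_trans a0 (xa n i).
have xb n i : (i <= n.+1)%N -> x n i <= b.
  move=> ilen; rewrite /x /h -lerBrDl mulrCA ler_piMr//.
  by rewrite ler_pdivrMr// mul1r ler_nat.
pose f n i s := 1 + e * (pole_ratio (x n i) (x n i.+1) s - 1).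
apply: (@mellin_fun_lim _ (fun n s => \prod_(i < n.+1) f n i s)).
  move=> n; apply: mellin_fun_prod => i _.
  exact: mellin_fun_pole_mix.
move=> s s0.
pose K := b / a * ((b - a) / a) ^+ 2.
have K0 : 0 <= K by rewrite mulr_ge0 ?sqr_ge0// divr_ge0// ltW.
(* A bound on the relative error of one factor, uniform in [i]: on each subinterval the quotient of
   the endpoints is at most [b / a] and the denominator is at least [a]. *)
pose d n : R := K / n.+1%:R ^+ 2.
have bnd n i : (i < n.+1)%N ->
    pole_ratio (x n i) (x n i.+1) s `^ e <= f n i s <=
    pole_ratio (x n i) (x n i.+1) s `^ e * (1 + d n).
  move=> ilen; have r01 : x n i / x n i.+1 <= pole_ratio (x n i) (x n i.+1) s <= 1.
    by rewrite pole_ratio_ge// pole_ratio_le1.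
  have /andP[-> /= h2] := pole_mix_bounds (x0 n i) (xx n i) e01 r01.
  apply: (le_trans h2); rewrite ler_wpM2l ?powR_ge0// lerD2l.
  have -> : d n = b / a * (h n / a) ^+ 2.
    have : n.+1%:R != 0 :> R by rewrite pnatr_eq0.
    by rewrite /d /h /K; move: (n.+1%:R) => k k0; field; rewrite k0 gt_eqF.
  have -> : x n i.+1 - x n i = h n by rewrite xS; ring.
  have q0 : 0 <= h n / x n i.+1 by rewrite divr_ge0// ltW.
  apply: ler_pM; rewrite ?sqr_ge0 ?divr_ge0 ?(ltW (x0 _ _))//.
    apply: ler_pM; rewrite ?invr_ge0 ?(ltW (x0 _ _)) ?xb//.
    by rewrite lef_pV2 ?posrE.
  rewrite ler_sqr ?nnegrE//; last by rewrite divr_ge0// ltW.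
  by rewrite ler_wpM2l// lef_pV2 ?posrE.
(* The ratios telescope by [pole_ratioM], while the errors accumulate to [(1 + d n) ^ j]; for
   [j = n + 1] this is at most [exp (K / (n + 1))]. *)
have prod_bnd n j : (j <= n.+1)%N ->
    pole_ratio a (x n j) s `^ e <= \prod_(i < j) f n i s <=
    pole_ratio a (x n j) s `^ e * (1 + d n) ^+ j.
  elim: j => [_|j ih jn].
    rewrite big_ord0 expr0 mulr1 /x mul0r addr0.
    have -> : pole_ratio a a s = 1 by rewrite /pole_ratio divff// gt_eqF// mulr_gt0// ltr_wpDr.
    by rewrite powR1 lexx.
  have /andP[l1 u1] := ih (ltnW jn); have /andP[l2 u2] := bnd n j jn.
  rewrite big_ord_recr/= -(@pole_ratioM _ a (x n j))//.
  rewrite powRM ?(ltW (pole_ratio_gt0 _ _ _))//.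
  rewrite ler_pM ?powR_ge0//=.
  have f0 : 0 <= f n j s by rewrite (le_trans _ l2)// powR_ge0.
  have p0 : 0 <= \prod_(i < j) f n i s by rewrite (le_trans _ l1)// powR_ge0.
  apply: (le_trans (ler_pM p0 f0 u1 u2)).
  by rewrite exprSr; lra.
have xn n : x n n.+1 = b by rewrite /x /h mulrCA divff ?pnatr_eq0// mulr1 addrC subrK.
apply: (@squeeze_cvgr _ _ _ _ (fun=> pole_ratio a b s `^ e)
    (fun n => pole_ratio a b s `^ e * expR (K * harmonic n))).
- apply: nearW => n; have /andP[+ h2] := prod_bnd n n.+1 (leqnn _).
  rewrite xn => -> /=; apply: (le_trans h2); rewrite xn ler_wpM2l ?powR_ge0//.
  have -> : K * harmonic n = n.+1%:R * d n.
    have : n.+1%:R != 0 :> R by rewrite pnatr_eq0.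
    by rewrite /d /harmonic/=; move: (n.+1%:R) => k k0; field.
  rewrite expRM_natl lerXn2r ?nnegrE ?expR_ge0//.
    by rewrite addr_ge0// divr_ge0// sqr_ge0.
  exact: expR_ge1Dx.
- exact: cvg_cst.
rewrite -[X in _ --> X]mulr1; apply: cvgMr; rewrite -expR0.
apply: continuous_cvg; first exact: continuous_expR.
by rewrite -[X in _ --> X](mulr0 K); apply: cvgMr; exact: cvg_harmonic.
Qed.

(** The zero [-b] of [pole_ratio a b] is sent to infinity. For [e > 0] the limit is the Mellin
    function of [exp (- G / a)], with [G] a gamma variable of shape [e]. *)
Lemma mellin_fun_gamma_pow (R : realType) (a e : R) : 0 < a -> 0 <= e <= 1 ->
  mellin_fun (fun s => (a / (a + s)) `^ e).
Proof.
move=> a0 e01.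
apply: (@mellin_fun_lim _ (fun n s => pole_ratio a (a + n%:R) s `^ e)).
  by move=> n; apply: mellin_fun_pole_pow => //; rewrite lerDl.
move=> s s0; apply: cvg_powR_base.
- by case/andP: e01.
- by apply: nearW => n; rewrite ltW// pole_ratio_gt0// ltr_wpDr.
have -> : (fun n => pole_ratio a (a + n%:R) s) =
    (fun n => a / (a + s) * (1 + s * (a + n%:R)^-1)).
  apply/funext => n; rewrite /pole_ratio; field.
  by rewrite !gt_eqF// ltr_wpDr.
rewrite -[X in _ --> X]mulr1; apply: cvgMr.
rewrite -[X in _ --> X]addr0; apply: cvgD; first exact: cvg_cst.
rewrite -[X in _ --> X](mulr0 s); apply: cvgMr.
apply/gtr0_cvgV0; first by apply: nearW => n; rewrite ltr_wpDr.
apply/cvgryPge => A; near=> n.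
apply: (@le_trans _ _ n%:R); last by rewrite lerDr ltW.
by near: n; exact: nbhs_infty_ger.
Unshelve. all: by end_near. Qed.

(** * Gamma integrals *)

Section half_line.
Context (R : realType).
Implicit Types (f F : R -> R) (a k p D : R).

Let mu := @lebesgue_measure R.
Let H : set (measurableTypeR R) := `[0%R, +oo[%classic.

Lemma measurable_half_line : measurable H.
Proof. exact: measurable_itv. Qed.

Lemma within_continuous_measurable f :
  {within `[0, +oo[, continuous f} -> measurable_fun H f.
Proof.
move=> cf; apply: subspace_continuous_measurable_fun => //.
exact: measurable_half_line.
Qed.

Lemma continuous_expRM a : continuous (fun x : R => expR (- (a * x))).
Proof.
move=> x; apply: continuous_comp; last exact: continuous_expR.
by apply: cvgN; apply: cvgM; [exact: cvg_cst|exact: cvg_id].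
Qed.

Lemma cvg_expRM a : 0 < a -> expR (- (a * x)) @[x --> +oo] --> (0 : R).
Proof.
move=> a0.
apply: (@cvg_comp _ _ _ ( *%R a) (fun z => expR (- z)) _ (pinfty_nbhs R)).
  exact: gt0_cvgMry.
exact: cvgr_expR.
Qed.

Lemma integral_expR_half_line a : 0 < a ->
  (\int[mu]_(x in `[0%R, +oo[) (expR (- (a * x)))%:E = (a^-1)%:E)%E.
Proof.
move=> a0.
have cE := @continuous_expRM a.
rewrite (@ge0_continuous_FTC2y _ _ (fun x => - a^-1 * expR (- (a * x))) _ 0).
- by rewrite mulr0 oppr0 expR0 mulr1 sub0e EFinN oppeK.
- by move=> x _; exact: expR_ge0.
- exact: continuous_subspaceT.
- rewrite -[X in _ --> X](mulr0 (- a^-1)); apply: cvgMr.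
  exact: cvg_expRM.
- by move=> x _.
- by apply: cvgMr; apply: cvg_at_right_filter; exact: cE.
- move=> x _; rewrite derive1E derive_val /GRing.scale/=.
  by field; rewrite gt_eqF.
Qed.

Lemma integrable_expR_dominated f D a : 0 < a ->
  {within `[0, +oo[, continuous f} ->
  (forall x, 0 <= x -> `|f x| <= D * expR (- (a * x))) ->
  mu.-integrable H (EFin \o f).
Proof.
move=> a0 cf fD.
apply: (@le_integrable _ _ _ _ _ measurable_half_line _ (fun x => (D * expR (- (a * x)))%:E)).
- by apply/measurable_EFinP; exact: within_continuous_measurable.
- move=> x; rewrite /H/= in_itv/= andbT => x0; rewrite lee_fin.
  by rewrite (le_trans (fD _ x0))// ler_norm.
have cE := @continuous_expRM a.
under eq_fun do rewrite EFinM.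
apply: integrableZl; first exact: measurable_half_line.
apply/integrableP; split.
  apply/measurable_EFinP; apply: within_continuous_measurable.
  exact: continuous_subspaceT.
rewrite (_ : (\int[mu]_(x in H) _)%E = (a^-1)%:E) ?ltry//.
rewrite -integral_expR_half_line//; apply: eq_integral => x _.
by rewrite abse_EFin ger0_norm// expR_ge0.
Qed.

(** Adding [D exp (- a x)], whose integral is [D / a], makes the integrand nonnegative, and the
    fundamental theorem for nonnegative functions on a half-line applies. *)
Lemma expR_dominated_FTC f F D a (l : R) : 0 < a ->
  {within `[0, +oo[, continuous f} ->
  (forall x, 0 <= x -> `|f x| <= D * expR (- (a * x))) ->
  F x @[x --> +oo] --> l ->
  (forall x : R, 0 < x -> is_derive x (1 : R) F (f x)) -> F x @[x --> 0^'+] --> F 0 ->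
  (\int[mu]_(x in H) f x = l - F 0)%R.
Proof.
move=> a0 cf fD Fl dF F0.
pose e x : R := expR (- (a * x)).
have cE : continuous e := @continuous_expRM a.
have e_to0 : e x @[x --> +oo] --> (0 : R) := cvg_expRM a0.
have intf := integrable_expR_dominated a0 cf fD.
have inte : mu.-integrable H (EFin \o (fun x => D * e x)).
  apply: (@integrable_expR_dominated _ `|D| _ a0).
    by apply: continuous_subspaceT => x; apply: cvgMr; exact: cE.
  by move=> x x0; rewrite normrM (@ger0_norm _ (e x)) ?expR_ge0.
have Ie : (\int[mu]_(x in H) (D * e x) = D / a)%R.
  have inte1 : mu.-integrable H (EFin \o e).
    apply: (@integrable_expR_dominated _ 1 _ a0); first exact: continuous_subspaceT.
    by move=> x x0; rewrite mul1r ger0_norm// expR_ge0.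
  rewrite RintegralZl//; last exact: measurable_half_line.
  congr (_ * _).
  by rewrite /Rintegral integral_expR_half_line.
have : (\int[mu]_(x in H) (f x + D * e x) = l - F 0 + D / a)%R.
  rewrite /Rintegral.
  rewrite (@ge0_continuous_FTC2y _ (fun x => f x + D * e x)
    (fun x => F x - D / a * e x) _ l)//=.
  - by rewrite /e mulr0 oppr0 expR0 mulr1; ring.
  - by move=> x /fD; rewrite ler_norml => /andP[+ _]; rewrite /e; lra.
  - move=> x; apply: cvgD; first exact: cf.
    by apply: cvgMr; apply: continuous_subspaceT; exact: cE.
  - rewrite -[X in _ --> X]subr0; apply: cvgB => //.
    by rewrite -[X in _ --> X](mulr0 (D / a)); exact: cvgMr.
  - by move=> x /dF ?.
  - by apply: cvgB => //; apply: cvgMr; apply: cvg_at_right_filter; exact: cE.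
  - move=> x; rewrite in_itv/= andbT => /dF dFx.
    rewrite derive1E derive_val /GRing.scale/= /e.
    by field; rewrite gt_eqF.
rewrite RintegralD//; last exact: measurable_half_line.
by rewrite Ie => /addIr.
Qed.

Lemma powR_le_expR p k : 0 <= p -> 0 < k ->
  exists2 C, 0 < C & forall x, 0 <= x -> x `^ p <= C * expR (k * x).
Proof.
move=> p0 k0; pose n := Num.truncn p.
(* From [x ^ p <= 1 + x ^ (n + 1)] and the term of order [n + 1] in the series of [exp (k x)]. *)
exists (1 + n.+1`!%:R / k ^+ n.+1).
  by rewrite ltr_wpDr// divr_ge0// exprn_ge0// ltW.
move=> x x0; have pn : p <= n.+1%:R by rewrite ltW// truncnS_gt.
have kx : 0 <= k * x by rewrite mulr_ge0// ltW.
have e1 : 1 <= expR (k * x) by rewrite -expR0 ler_expR.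
have h1 : x `^ p <= 1 + x ^+ n.+1.
  have [x1|x1] := leP x 1.
    rewrite (@le_trans _ _ 1)// ?lerDl ?exprn_ge0//.
    have [->|px] := eqVneq x 0.
      by rewrite /powR eqxx lern1 leq_b1.
    have xp : 0 < x <= 1 by rewrite lt_neqAle eq_sym px x0.
    by rewrite -(powRr0 x) ger_powR.
  rewrite ler_wpDl// -powR_mulrn//.
  by rewrite ler_powR// ltW.
apply: (le_trans h1); rewrite mulrDl mul1r lerD//.
have := expR_ge1Dxn n kx; rewrite exprMn.
have f0 : 0 < n.+1`!%:R :> R by rewrite ltr0n fact_gt0.
have kn : 0 < k ^+ n.+1 by rewrite exprn_gt0.
move: (n.+1`!%:R) (k ^+ n.+1) (x ^+ n.+1) f0 kn => A B Z A0 B0 H1.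
have {}H1 : B * Z / A <= expR (k * x) by lra.
rewrite mulrAC ler_pdivlMr//; rewrite ler_pdivrMr// in H1; lra.
Qed.

End half_line.

Lemma is_derive_powR (R : realType) (x p : R) : 0 < x ->
  is_derive x (1 : R) (fun t : R => t `^ p) (p * x `^ (p - 1)).
Proof.
move=> x0; have x0' : x \in `]0, +oo[ by rewrite in_itv/= x0.
apply: DeriveDef; first exact: derivable_powR.
by rewrite -derive1E powR_derive1.
Qed.

(* Equal to [Gamma (p + 1) / k ^ (p + 1)] for [k > 0]. *)
Definition gamma_int (R : realType) (k p : R) : R :=
  \int[@lebesgue_measure R]_(t in `[0%R, +oo[) (t `^ p * expR (- (k * t))).

Section gamma_int.
Context (R : realType) (k : R) (k0 : 0 < k).
Implicit Types p s y : R.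
Let mu := @lebesgue_measure R.
Let H : set (measurableTypeR R) := `[0%R, +oo[%classic.

Let mH : measurable H.
Proof. exact: measurable_half_line. Qed.

(** Half of the exponential decay absorbs the power. *)
Lemma powR_expR_dominated p : 0 <= p -> exists2 C, 0 < C &
  forall t, 0 <= t -> `|t `^ p * expR (- (k * t))| <= C * expR (- (k / 2 * t)).
Proof.
move=> p0; have k2 : 0 < k / 2 by rewrite divr_gt0.
have [C C0 HC] := powR_le_expR p0 k2; exists C => // t t0.
rewrite ger0_norm ?mulr_ge0 ?powR_ge0 ?expR_ge0//.
have -> : - (k * t) = k / 2 * - t + - (k / 2 * t) by field.
rewrite expRD mulrA ler_pM2r ?expR_gt0//.
by rewrite mulrN expRN ler_pdivrMr ?expR_gt0// HC.
Qed.

Lemma powR_expR_continuous p : 0 <= p ->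
  {within `[0, +oo[, continuous (fun t => t `^ p * expR (- (k * t)))}.
Proof.
move=> p0 t; apply: cvgM; first exact: powR_within_continuous.
by apply: continuous_subspaceT; exact: continuous_expRM.
Qed.

Lemma integrable_gamma_int p : 0 <= p ->
  mu.-integrable H (EFin \o (fun t => t `^ p * expR (- (k * t)))).
Proof.
move=> p0; have [C C0 HC] := powR_expR_dominated p0.
apply: integrable_expR_dominated HC; first by rewrite divr_gt0.
exact: powR_expR_continuous.
Qed.

Lemma powR_expR_to0 p : 0 <= p ->
  t `^ p * expR (- (k * t)) @[t --> +oo] --> (0 : R).
Proof.
move=> p0; have [C C0 HC] := powR_expR_dominated p0.
apply: (@squeeze_cvgr _ _ _ _ (fun=> 0) (fun t => C * expR (- (k / 2 * t)))).
- near=> t; have t0 : 0 <= t by near: t; exact: nbhs_pinfty_ge.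
  rewrite mulr_ge0 ?powR_ge0 ?expR_ge0//=.
  by rewrite (le_trans _ (HC _ t0))// ler_norm.
- exact: cvg_cst.
- rewrite -[X in _ --> X](mulr0 C); apply: cvgMr; apply: cvg_expRM.
  by rewrite divr_gt0.
Unshelve. all: by end_near. Qed.

Lemma powR_at_right0 p : 0 <= p -> t `^ p @[t --> (0 : R)^'+] --> 0 `^ p.
Proof.
move=> p0; apply: cvg_powR_base => //.
- by near=> t; near: t; exact: nbhs_right_ge.
- exact: cvg_at_right_filter.
Unshelve. all: by end_near. Qed.

(** Integration by parts: [t ^ (p + 1) exp (- k t)] vanishes at both ends, so its derivative
    integrates to 0. *)
Lemma gamma_intS p : 0 <= p -> gamma_int k (p + 1) = (p + 1) / k * gamma_int k p.
Proof.
move=> p0; have p1 : 0 <= p + 1 by rewrite addr_ge0.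
have p1N : p + 1 != 0 by rewrite gt_eqF// ltr_wpDl.
have [C C0 HC] := powR_expR_dominated p0.
have [C1 C10 HC1] := powR_expR_dominated p1.
have i0 := integrable_gamma_int p0; have i1 := integrable_gamma_int p1.
pose f t := (p + 1) * (t `^ p * expR (- (k * t))) -
             k * (t `^ (p + 1) * expR (- (k * t))).
have : (\int[mu]_(t in H) f t = 0 - 0 `^ (p + 1) * expR (- (k * 0)))%R.
  apply: (@expR_dominated_FTC _ f (fun t => t `^ (p + 1) * expR (- (k * t)))
    ((p + 1) * C + k * C1) (k / 2)).
  - by rewrite divr_gt0.
  - by move=> t; apply: cvgB; apply: cvgMr; exact: powR_expR_continuous.
  - move=> t t0; rewrite mulrDl; apply: (le_trans (ler_normB _ _)); apply: lerD.
      rewrite normrM (ger0_norm p1) -mulrA ler_wpM2l//; exact: HC.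
    rewrite normrM (gtr0_norm k0) -mulrA ler_pM2l//; exact: HC1.
  - exact: powR_expR_to0.
  - move=> t t0; have ? := is_derive_powR (p + 1) t0.
    apply: is_derive_eq; rewrite /GRing.scale/= /f addrK; ring.
  - apply: cvgM; first exact: powR_at_right0.
    by apply: cvg_at_right_filter; exact: continuous_expRM.
rewrite powR0// mul0r subr0 /f RintegralB//; last 2 first.
- exact: eq_integrable (integrableZl _ (p + 1) i0).
- exact: eq_integrable (integrableZl _ k i1).
rewrite !RintegralZl//.
rewrite -/(gamma_int k p) -/(gamma_int k (p + 1)) => E.
move: (gamma_int k p) (gamma_int k (p + 1)) E => A B E.
apply: (mulfI (lt0r_neq0 k0)); rewrite mulrA mulrCA divff ?lt0r_neq0// mulr1.
by apply/esym/eqP; rewrite -subr_eq0 E.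
Qed.

Lemma gamma_int0 : gamma_int k 0 = k^-1.
Proof.
rewrite /gamma_int /Rintegral.
under eq_integral do rewrite powRr0 mul1r.
by rewrite integral_expR_half_line.
Qed.

Lemma gamma_int_gt0 p : 0 <= p -> 0 < gamma_int k p.
Proof.
move=> p0; have ip := integrable_gamma_int p0.
pose I : set (measurableTypeR R) := `[1%R, 2%R]%classic.
have mI : measurable I by exact: measurable_itv.
have IH : I `<=` H.
  by move=> t; rewrite /I /H/= !in_itv/= andbT => /andP[/(le_trans ler01)].
have h1 : (\int[mu]_(t in I) (expR (- (k * 2)))%:E <=
    \int[mu]_(t in H) (t `^ p * expR (- (k * t)))%:E)%E.
  apply: (@le_trans _ _ (\int[mu]_(t in I) (t `^ p * expR (- (k * t)))%:E)%E).
    apply: ge0_le_integral => //.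
    - by case/integrableP : (integrableS mH mI IH ip).
    - move=> t; rewrite /I/= in_itv/= => /andP[t1 t2]; rewrite lee_fin.
      rewrite -[leLHS]mul1r ler_pM ?expR_ge0//.
        by rewrite -(powRr0 t) ler_powR.
      by rewrite ler_expR lerN2 ler_pM2l.
  apply: ge0_subset_integral => //.
  - by case/integrableP : ip.
  - by move=> t _; rewrite lee_fin mulr_ge0 ?powR_ge0 ?expR_ge0.
rewrite (@lt_le_trans _ _ (expR (- (k * 2))))// ?expR_gt0//.
rewrite -lee_fin /gamma_int /Rintegral fineK; last first.
  exact: integrable_fin_num.
apply: le_trans h1.
have <- : (expR (- (k * 2)))%:E = (\int[mu]_(t in I) (expR (- (k * 2)))%:E)%E.
  rewrite integral_cst// -[LHS]mule1; congr (_ * _)%E.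
  have -> : 1%E = lebesgue_measure I :> \bar R; last by [].
  rewrite lebesgue_measure_itv/= lte_fin ltr1n/= -EFinB.
  by congr (_%:E); ring.
by [].
Qed.

(** Jensen's inequality for the concave function [t ^ s] under the weight [t ^ p exp (- k t)], whose
    mean is [m = (p + 1) / k]. The tangent at [m] dominates pointwise, and its linear part
    integrates to 0. *)
Lemma gamma_int_le p s : 0 <= p -> 0 <= s <= 1 ->
  gamma_int k (p + s) <= ((p + 1) / k) `^ s * gamma_int k p.
Proof.
move=> p0 s01; have /andP[s0 s1] := s01.
pose m := (p + 1) / k; have p1 : 0 < p + 1 by rewrite ltr_wpDl.
have m0 : 0 < m by rewrite divr_gt0.
have ip := integrable_gamma_int p0.
have ip1 := integrable_gamma_int (ltW p1).
have ips := integrable_gamma_int (addr_ge0 p0 s0).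
pose g t := m `^ s * (1 - s) * (t `^ p * expR (- (k * t))) +
  m `^ s * s / m * (t `^ (p + 1) * expR (- (k * t))).
have ig1 : mu.-integrable H (EFin \o (fun t => m `^ s * (1 - s) * (t `^ p * expR (- (k * t))))).
  by apply: eq_integrable (integrableZl mH _ ip).
have ig2 : mu.-integrable H (EFin \o (fun t => m `^ s * s / m * (t `^ (p + 1) * expR (- (k * t))))).
  by apply: eq_integrable (integrableZl mH _ ip1).
have ig : mu.-integrable H (EFin \o g).
  by apply: eq_integrable (integrableD mH ig1 ig2).
apply: (@le_trans _ _ (\int[mu]_(t in H) g t)%R).
  apply: le_Rintegral => // t; rewrite /H/= in_itv/= andbT => t0.
  (* At [t = 0] the powers cannot be split, since zero to the power zero is 1; the left side is
     nonzero there only for [p = s = 0]. *)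
  rewrite /g; have [->|tN] := eqVneq t 0.
    rewrite !mulr0 oppr0 expR0 !mulr1 (powR0 (lt0r_neq0 p1)) mulr0 addr0.
    have [ps|ps] := eqVneq (p + s) 0; last first.
      by rewrite powR0// mulr_ge0 ?powR_ge0// mulr_ge0 ?powR_ge0 ?subr_ge0.
    have pE : p = 0 by lra.
    have sE : s = 0 by lra.
    by rewrite pE sE addr0 powRr0 powRr0 subr0 !mulr1.
  have t1 : 0 < t by rewrite lt_neqAle eq_sym tN.
  rewrite powRD ?tN ?implybT// powRD ?tN ?implybT// powRr1//.
  have -> : t `^ s = m `^ s * (t / m) `^ s.
    rewrite -powRM ?(ltW m0) ?(ltW (divr_gt0 t1 m0))//.
    by congr (_ `^ _); field; exact: lt0r_neq0.
  have := @bernoulli_powR _ s (t / m) s01 (divr_gt0 t1 m0).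
  have W0 : 0 <= m `^ s * (t `^ p * expR (- (k * t))).
    by rewrite !mulr_ge0 ?powR_ge0 ?expR_ge0.
  move=> /(ler_wpM2l W0) HW.
  have E1 : t `^ p * (m `^ s * (t / m) `^ s) * expR (- (k * t)) =
    m `^ s * (t `^ p * expR (- (k * t))) * (t / m) `^ s by ring.
  rewrite E1; apply: (le_trans HW); rewrite le_eqVlt; apply/orP; left; apply/eqP.
  by field; exact: lt0r_neq0.
rewrite RintegralD// !RintegralZl//.
rewrite -/(gamma_int k p) -/(gamma_int k (p + 1)) gamma_intS// -/m.
rewrite le_eqVlt; apply/orP; left; apply/eqP; field; exact: lt0r_neq0.
Qed.

End gamma_int.

(** * Gauss's product *)

Lemma cvg_shift_ratio (R : realType) (c : R) :
  (c + n%:R) / n%:R @[n --> \oo] --> (1 : R).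
Proof.
have H : 1 + c * n%:R^-1 @[n --> \oo] --> (1 : R).
  rewrite -[X in _ --> X]addr0; apply: cvgD; first exact: cvg_cst.
  rewrite -[X in _ --> X](mulr0 c); apply: cvgMr.
  apply/gtr0_cvgV0; last exact: cvgr_idn.
  by exists 1%N => // n /= n0; rewrite ltr0n.
apply: cvg_trans H; apply: near_eq_cvg; exists 1%N => // n /= n0.
by rewrite mulrDl divff ?pnatr_eq0 -?lt0n// addrC.
Qed.

Section gauss_product.
Context (R : realType) (k : R) (k0 : 0 < k).
Implicit Types p s y : R.

(** Wendel's inequalities for [0 <= y <= 1]: [gamma_int_le] from [p + n] to [p + n + y] bounds the
    ratio above, and from [p + n + y] to [p + n + 1] below. The functional equation then moves [y]
    up by integers. *)
Lemma gamma_int_ratio_cvg p y : 0 <= p -> 0 <= y ->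
  gamma_int k (p + n%:R + y) / (gamma_int k (p + n%:R) * n%:R `^ y) @[n --> \oo]
    --> (k^-1) `^ y.
Proof.
move=> p0; have kV : 0 < k^-1 by rewrite invr_gt0.
have pn0 n : 0 <= p + n%:R by rewrite addr_ge0.
have G0 n s : 0 <= s -> 0 < gamma_int k (p + n%:R + s).
  by move=> s0; apply: gamma_int_gt0 => //; exact: addr_ge0.
have lin c : (c + n%:R) / k / n%:R @[n --> \oo] --> (k^-1 : R).
  rewrite (_ : (fun n : nat => _) = (fun n => (c + n%:R) / n%:R * k^-1)).
    by rewrite -[X in _ --> X]mul1r; apply: cvgMl; exact: cvg_shift_ratio.
  by apply/funext => n; rewrite mulrAC.
have base s : 0 <= s <= 1 ->
    gamma_int k (p + n%:R + s) / (gamma_int k (p + n%:R) * n%:R `^ s) @[n --> \oo]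
      --> (k^-1) `^ s.
  move=> s01; have /andP[s0 s1] := s01.
  have s1' : 0 <= 1 - s <= 1 by lra.
  apply: (@squeeze_cvgr _ _ _ _
    (fun n => ((p + 1 + n%:R) / k / n%:R) *
              ((((p + s + 1 + n%:R) / k) / n%:R) `^ (1 - s))^-1)
    (fun n => ((p + 1 + n%:R) / k / n%:R) `^ s)).
  - exists 1%N => // n /= n1; have n0 : 0 < n%:R :> R by rewrite ltr0n.
    have m0 : 0 < (p + 1 + n%:R) / k by rewrite divr_gt0// ltr_wpDl// addr_ge0.
    have m1 : 0 < (p + s + 1 + n%:R) / k.
      by rewrite divr_gt0// ltr_wpDl// !addr_ge0.
    have Gn : 0 < gamma_int k (p + n%:R) by rewrite -[p + _]addr0 G0.
    apply/andP; split.
      have := gamma_int_le k0 (addr_ge0 (pn0 n) s0) s1'.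
      rewrite (_ : p + n%:R + s + (1 - s) = p + n%:R + 1); last by ring.
      rewrite gamma_intS// (_ : p + n%:R + 1 = p + 1 + n%:R); last by ring.
      rewrite (_ : p + n%:R + s + 1 = p + s + 1 + n%:R); last by ring.
      set a := gamma_int k _; set b := gamma_int k _ in Gn *.
      move: m0 m1; set m := _ / k; set M := _ / k => m0 m1 H.
      have q0 : 0 < n%:R `^ s by rewrite powR_gt0.
      have M0 : 0 < M `^ (1 - s) by rewrite powR_gt0.
      have u0 : 0 < n%:R^-1 `^ (1 - s) by rewrite powR_gt0// invr_gt0.
      have qr : n%:R = n%:R `^ s * n%:R `^ (1 - s).
        by rewrite -powRD ?pnatr_eq0 -?lt0n ?n1 ?implybT// addrC subrK powRr1// ltW.
      have ru : n%:R `^ (1 - s) * n%:R^-1 `^ (1 - s) = 1.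
        by rewrite -powRM ?invr_ge0 ?(ltW n0)// divff ?powR1// gt_eqF.
      rewrite powRM ?invr_ge0 ?(ltW m1) ?(ltW n0)//.
      rewrite ler_pdivlMr ?mulr_gt0//.
      have r0 : 0 < n%:R `^ (1 - s) by rewrite powR_gt0.
      have -> : n%:R^-1 `^ (1 - s) = (n%:R `^ (1 - s))^-1.
        by apply: (mulfI (lt0r_neq0 r0)); rewrite ru divff// lt0r_neq0.
      have -> : m / n%:R / (M `^ (1 - s) * (n%:R `^ (1 - s))^-1) * (b * n%:R `^ s) =
          (m * b) / M `^ (1 - s).
        rewrite {1}qr; move: q0 r0 M0.
        move: (n%:R `^ s) (n%:R `^ (1 - s)) (M `^ (1 - s)) => q r M' q0 r0 M0.
        by field; rewrite !gt_eqF.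
      by rewrite ler_pdivrMr// mulrC [leRHS]mulrC mulrC.
    rewrite ler_pdivrMr ?mulr_gt0 ?powR_gt0//.
    rewrite (le_trans (gamma_int_le k0 (pn0 n) s01))//.
    rewrite (_ : p + n%:R + 1 = p + 1 + n%:R); last by ring.
    move: m0; set m := (_ / k) => m0.
    have -> : m `^ s = (m / n%:R) `^ s * n%:R `^ s.
      have mn : 0 <= m / n%:R := ltW (divr_gt0 m0 n0).
      rewrite -(powRM s mn (ltW n0)); congr (_ `^ _).
      by field; rewrite !gt_eqF.
    by rewrite mulrAC mulrA.
  - have -> : k^-1 `^ s = k^-1 * (k^-1 `^ (1 - s))^-1.
      apply: (mulIf (lt0r_neq0 (powR_gt0 (1 - s) kV))).
      rewrite divfK ?lt0r_neq0 ?powR_gt0// -powRD ?(gt_eqF kV) ?implybT//.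
      by rewrite addrC subrK powRr1// ltW.
    apply: cvgM; first exact: lin.
    apply: cvgV; first by rewrite gt_eqF// powR_gt0.
    apply: cvg_powR_base; [by case/andP : s1'| |exact: lin].
    by apply: nearW => n; rewrite !divr_ge0// ?(ltW k0)// !addr_ge0.
  - apply: cvg_powR_base; [by []| |exact: lin].
    by apply: nearW => n; rewrite !divr_ge0// ?(ltW k0)// !addr_ge0.
have step s : 0 <= s ->
    gamma_int k (p + n%:R + s) / (gamma_int k (p + n%:R) * n%:R `^ s) @[n --> \oo]
      --> k^-1 `^ s ->
    gamma_int k (p + n%:R + (s + 1)) / (gamma_int k (p + n%:R) * n%:R `^ (s + 1)) @[n --> \oo]
      --> k^-1 `^ (s + 1).
  move=> s0 H; rewrite powRD ?(gt_eqF kV) ?implybT// powRr1 ?(ltW kV)//.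
  apply: cvg_trans (cvgM H (lin (p + s + 1))); apply: near_eq_cvg; exists 1%N => // n /= n1.
  have n0 : 0 < n%:R :> R by rewrite ltr0n.
  rewrite addrA gamma_intS ?addr_ge0//.
  rewrite powRD ?pnatr_eq0 -?lt0n ?n1 ?implybT// powRr1 ?(ltW n0)//.
  have Gn : 0 < gamma_int k (p + n%:R) by rewrite -[p + _]addr0 G0.
  have q0 : 0 < n%:R `^ s by rewrite powR_gt0.
  rewrite (_ : p + n%:R + s + 1 = p + s + 1 + n%:R); last by ring.
  move: (p + s + 1 + n%:R) (gamma_int k (p + n%:R + s)) => M B.
  move: (gamma_int k (p + n%:R)) (n%:R `^ s) (n%:R : R) Gn q0 n0.
  by move=> A C D A0 C0 D0; rewrite /=; field; rewrite !gt_eqF.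
move=> y0; pose m := Num.truncn y.
have ym : 0 <= y - m%:R <= 1.
  have /andP[h1 h2] := truncn_itv y0; rewrite -natr1 -/m in h2; lra.
have {y0} -> : y = (y - m%:R) + m%:R by rewrite subrK.
move: (y - m%:R) ym => s s01; elim: m => [|m ih]; first by rewrite addr0; exact: base.
rewrite -natr1 addrA; apply: step => //.
by rewrite addr_ge0//; case/andP : s01.
Qed.

Lemma gamma_intn p n : 0 <= p ->
  gamma_int k (p + n%:R) = (\prod_(j < n) (p + 1 + j%:R)) / k ^+ n * gamma_int k p.
Proof.
move=> p0; elim: n => [|n ih]; first by rewrite addr0 big_ord0 expr0 divr1 mul1r.
rewrite -natr1 addrA (gamma_intS k0 (addr_ge0 p0 (ler0n R n))) ih big_ord_recr/= exprSr.
move: (\prod_(_ < _) _) (gamma_int k p) => P G.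
by field; rewrite expf_eq0 !gt_eqF ?andbF.
Qed.

(** The functional equation writes the product through gamma integrals at [p + n] and [p + n + y],
    whose ratio is known asymptotically. The factor [k ^ y] undoes the scaling by [k]: the limit is
    [Gamma (p + y + 1) / Gamma (p + 1)]. *)
Lemma gauss_product p y : 0 <= p -> 0 <= y ->
  n%:R `^ y * \prod_(j < n) ((p + 1 + j%:R) / (p + 1 + j%:R + y)) @[n --> \oo]
    --> k `^ y * gamma_int k (p + y) / gamma_int k p.
Proof.
move=> p0 y0; have py0 : 0 <= p + y by rewrite addr_ge0.
have Gp := gamma_int_gt0 k0 p0; have Gpy := gamma_int_gt0 k0 py0.
have ky : 0 < k^-1 `^ y by rewrite powR_gt0// invr_gt0.
have -> : k `^ y = (k^-1 `^ y)^-1.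
  by rewrite -powRN -powR_inv1 ?ltW// -powRrM mulN1r opprK.
have H : (gamma_int k (p + n%:R + y) / (gamma_int k (p + n%:R) * n%:R `^ y))^-1 *
    (gamma_int k (p + y) / gamma_int k p) @[n --> \oo] -->
    (k^-1 `^ y)^-1 * (gamma_int k (p + y) / gamma_int k p).
  apply: cvgMl; apply: cvgV; first exact: lt0r_neq0.
  exact: gamma_int_ratio_cvg.
rewrite -mulrA; apply: cvg_trans H; apply: near_eq_cvg; exists 1%N => // n /= n1.
have n0 : 0 < n%:R :> R by rewrite ltr0n.
rewrite -addrA [n%:R + y]addrC addrA !gamma_intn//.
rewrite prodf_div.
have P1 : 0 < \prod_(j < n) (p + 1 + j%:R) by apply: prodr_gt0 => j _; rewrite ltr_wpDr// ltr_wpDl.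
have -> : \prod_(j < n) (p + 1 + j%:R + y) = \prod_(j < n) (p + y + 1 + j%:R).
  by apply: eq_bigr => j _; ring.
have P2 : 0 < \prod_(j < n) (p + y + 1 + j%:R) by apply: prodr_gt0 => j _; rewrite ltr_wpDr// ltr_wpDl.
have q0 : 0 < n%:R `^ y by rewrite powR_gt0.
have kn : 0 < k ^+ n by rewrite exprn_gt0.
move: (\prod_(_ < _) _) (\prod_(_ < _) _) (_ `^ _) (_ `^ _) (k ^+ n) P1 P2 q0 ky kn.
move: (gamma_int k _) (gamma_int k _) Gp Gpy => A B A0 B0 P Q u v w P0 Q0 u0 v0 w0.
by field; rewrite !gt_eqF.
Qed.

End gauss_product.

Lemma mellin_fun_gamma_pow_ge0 (R : realType) (a e : R) : 0 < a -> 0 <= e ->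
  mellin_fun (fun s => (a / (a + s)) `^ e).
Proof.
move=> a0 e0; pose m := (Num.truncn e).+1.
have em : e < m%:R by exact: truncnS_gt.
have m0 : 0 < m%:R :> R by rewrite ltr0n.
apply: (@eq_mellin_fun _ (fun s => \prod_(i < m) (a / (a + s)) `^ (e / m%:R))).
  move=> s s0; rewrite prodr_const card_ord -powR_mulrn ?powR_ge0// -powRrM.
  by rewrite divfK// lt0r_neq0.
apply: (@mellin_fun_prod _ (fun _ s => (a / (a + s)) `^ (e / m%:R))) => i _.
apply: mellin_fun_gamma_pow => //.
by rewrite divr_ge0//= ?(ltW m0)// ler_pdivrMr// mul1r ltW.
Qed.

Lemma powR_prod (R : realType) n (f : nat -> R) (c : R) :
  (forall i, 0 <= f i) -> (\prod_(i < n) f i) `^ c = \prod_(i < n) f i `^ c.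
Proof.
move=> f0; elim: n => [|n ih]; first by rewrite !big_ord0 powR1.
by rewrite !big_ord_recr/= powRM// ?ih// prodr_ge0.
Qed.

(** Gauss's product with [p = 0] and [y = 2 s], raised to the power [c]. Its prefactor belongs to
    the constant variable [n ^ (2 c)], and its poles in [s] are at [- (1 + j) / 2]. *)
Lemma mellin_fun_gamma (R : realType) (c : R) : 0 <= c ->
  mellin_fun (fun s => gamma_int 1 (2 * s) `^ c).
Proof.
move=> c0.
apply: (@mellin_fun_lim _ (fun n s => (n%:R `^ (2 * c)) `^ s *
    \prod_(j < n) ((1 + j%:R) / 2 / ((1 + j%:R) / 2 + s)) `^ c)).
  move=> n; apply: mellin_funM; first exact/mellin_fun_pow/powR_ge0.
  apply: (@mellin_fun_prod _ (fun j s => ((1 + j%:R) / 2 / ((1 + j%:R) / 2 + s)) `^ c)).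
  move=> j _; apply: mellin_fun_gamma_pow_ge0 => //.
move=> s s0; have s20 : 0 <= 2 * s by rewrite mulr_ge0.
have H := @gauss_product R 1 ltr01 0 (2 * s) (lexx _) s20.
rewrite powR1 mul1r !add0r gamma_int0// invr1 divr1 in H.
have {}H : (n%:R `^ (2 * s) * \prod_(j < n) ((1 + j%:R) / (1 + j%:R + 2 * s))) `^ c
    @[n --> \oo] --> gamma_int 1 (2 * s) `^ c.
  apply: cvg_powR_base => //.
    by apply: nearW => n; rewrite mulr_ge0 ?powR_ge0// prodr_ge0// => j _; rewrite divr_ge0// !addr_ge0.
apply: cvg_trans H; apply: near_eq_cvg; apply: nearW => n.
have f0 j : 0 <= (1 + j%:R) / (1 + j%:R + 2 * s) by rewrite divr_ge0// !addr_ge0.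
rewrite powRM ?powR_ge0 ?prodr_ge0//.
rewrite -!powRrM (@powR_prod R n (fun j => (1 + j%:R) / (1 + j%:R + 2 * s)))//.
congr (_ * _); first by congr (_ `^ _); ring.
apply: eq_bigr => j _; congr (_ `^ _).
have j1 : 0 < 1 + j%:R :> R by rewrite ltr_wpDr.
move: (1 + j%:R) j1 => x x0; field.
by rewrite !gt_eqF// ?mulr_gt0// ltr_wpDr ?mulr_ge0.
Qed.

Lemma Gamma_gamma_int (R : realType) (s : R) : 0 <= s ->
  Gamma (s + 1) = gamma_int 1 s.
Proof.
move=> s0; rewrite /Gamma /gamma_int -Rintegral_itv_obnd_cbnd; last first.
  apply: integrableS (integrable_gamma_int ltr01 s0) => //.
  by move=> t; rewrite /= !in_itv/= !andbT => /ltW.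
by apply: eq_Rintegral => t _; rewrite addrK mul1r.
Qed.

Lemma gamma_int_fact (R : realType) n : gamma_int 1 n%:R = n`!%:R :> R.
Proof.
elim: n => [|n ih]; first by rewrite gamma_int0// invr1.
by rewrite -natr1 gamma_intS// ih divr1 natr1 factS natrM.
Qed.

Lemma mellin_fun_represents (R : realType) (phi : R -> R) : mellin_fun phi ->
  exists mu : {measure set (measurableTypeR R) -> \bar R},
    stieltjes_represents mu (fun n => phi n%:R) /\
    forall s, 0 <= s -> mellin_transform mu s = (phi s)%:E.
Proof.
move=> /mellin_fun_measure[mu [mu0 muphi]]; exists mu; split=> //; split=> // n.
rewrite -muphi//; apply: eq_integral => t.
by rewrite inE/= in_itv/= andbT => t0; rewrite powR_mulrn.
Qed.

(** * Uniqueness *)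

Lemma nonneg_derive_ge0 (R : realType) (g dg : R -> R) (b : R) : 0 <= b ->
  (forall x : R, is_derive x (1 : R) g (dg x)) ->
  (forall x, 0 <= x -> 0 <= dg x) -> g 0 = 0 -> 0 <= g b.
Proof.
move=> b0 dgx dg0 g0; rewrite -g0.
have dE x : g^`()%classic x = dg x by rewrite derive1E; exact: derive_val.
apply: (@ger0_derive1_ndecr _ g 0 b) => //.
- by move=> x; rewrite in_itv/= dE => /andP[/ltW/dg0].
- apply: derivable_within_continuous => x _; exact: ex_derive.
Qed.

(** * Taylor's formula for the cosine *)

Section cos_taylor.
Context (R : realType).
Implicit Types a b : R.

(** Derivatives of the cosine are written as shifts by quarter turns, so that differentiating in [b]
    amounts to moving [a] by [pi / 2]. *)
Definition cos_taylor J a b : R :=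
  \sum_(j < J) b ^+ j / j`!%:R * cos (a + j%:R * (pi / 2)).

Lemma is_derive_expn_fact J (c b : R) :
  is_derive b (1 : R) (fun b => b ^+ J.+1 / J.+1`!%:R * c) (b ^+ J / J`!%:R * c).
Proof.
have -> : b ^+ J / J`!%:R * c = (c / J.+1`!%:R) * (J.+1%:R * b ^+ J).
  rewrite factS natrM; have f0 : J`!%:R != 0 :> R by rewrite pnatr_eq0 -lt0n fact_gt0.
  have J0 : J.+1%:R != 0 :> R by rewrite pnatr_eq0.
  by move: (J.+1%:R : R) (J`!%:R : R) J0 f0 => A B A0 B0; field; rewrite A0 B0.
move: (J.+1`!%:R) => A.
have -> : (fun b => b ^+ J.+1 / A * c) = (fun b => (c / A) * b ^+ J.+1).
  by apply/funext => x; ring.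
move: (c / A) => {A}C.
have H : is_derive b (1 : R) (fun b : R => b ^+ J.+1) (J.+1%:R * b ^+ J).
  have -> : (fun b : R => b ^+ J.+1) = (@id R) ^+ J.+1.
    by apply/funext => x; rewrite exprfctE.
  by apply: is_derive_eq; rewrite /GRing.scale/= mulr1.
exact: (is_deriveZ C H).
Qed.

Lemma is_derive_cos_taylor J a b :
  is_derive b (1 : R) (cos_taylor J.+1 a) (cos_taylor J (a + pi / 2) b).
Proof.
elim: J => [|J ih].
  rewrite /cos_taylor big_ord0.
  rewrite (_ : (fun b => _) = cst (cos a)); first exact: is_derive_cst.
  apply/funext => x; rewrite big_ord_recr big_ord0/= expr0 fact0 divr1.
  by rewrite add0r mul1r mul0r addr0.
rewrite (_ : cos_taylor J.+2 a = cos_taylor J.+1 a +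
   (fun b => b ^+ J.+1 / J.+1`!%:R * cos (a + J.+1%:R * (pi / 2)))); last first.
  by apply/funext => x; rewrite /cos_taylor big_ord_recr.
have aE : a + pi / 2 + J%:R * (pi / 2) = a + J.+1%:R * (pi / 2).
  by rewrite -natr1; ring.
have d1 := is_derive_expn_fact J (cos (a + J.+1%:R * (pi / 2))) b.
have := is_deriveD ih d1; rewrite [X in is_derive _ _ _ X -> _](_ : _ = cos_taylor J.+1 (a + pi / 2) b)//.
by rewrite [RHS]/cos_taylor big_ord_recr/= aE.
Qed.

Lemma cos_taylor0 J a : cos_taylor J.+1 a 0 = cos a.
Proof.
rewrite /cos_taylor big_ord_recl/= expr0 fact0 divr1 mul1r mul0r addr0 big1 ?addr0//.
by move=> j _; rewrite expr0n/= mul0r mul0r.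
Qed.

(** Induction on [J]: the derivative of the remainder in [b] is the remainder of order [J - 1] at
    [a + pi / 2], and both sides of the bound are compared through their derivatives. *)
Lemma cos_taylor_bound J a b : 0 <= b ->
  `|cos (a + b) - cos_taylor J a b| <= b ^+ J / J`!%:R.
Proof.
elim: J a b => [|J ih] a b b0.
  by rewrite /cos_taylor big_ord0 subr0 expr0 fact0 divr1 cos_max.
have dP x : is_derive x (1 : R) (fun b : R => b ^+ J.+1 / J.+1`!%:R) (x ^+ J / J`!%:R).
  have := is_derive_expn_fact J 1 x; rewrite mulr1.
  by under eq_fun do rewrite mulr1.
have dC x : is_derive x (1 : R) (fun b => cos (a + b)) (cos (a + pi / 2 + x)).
  have -> : cos (a + pi / 2 + x) = - sin (a + x) by rewrite addrAC cosDpihalf.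
  have dcos : is_derive (a + x) (1 : R) cos (- sin (a + x)) by exact: is_derive_cos.
  have := @is_derive1_comp _ cos (fun b => a + b) x _ 1 dcos.
  rewrite mulr1; apply.
  have := is_deriveD (is_derive_cst a x 1) (is_derive_id x (1 : R)).
  by rewrite add0r.
have dT x := is_derive_cos_taylor J a x.
rewrite ler_norml; apply/andP; split.
  rewrite -subr_ge0 opprK.
  apply: (@nonneg_derive_ge0 _ (fun b => cos (a + b) - cos_taylor J.+1 a b + b ^+ J.+1 / J.+1`!%:R)
   (fun x => cos (a + pi / 2 + x) - cos_taylor J (a + pi / 2) x + x ^+ J / J`!%:R)) => //.
  - by move=> x /(ih (a + pi / 2)); rewrite ler_norml => /andP[+ _]; lra.
  - by rewrite cos_taylor0 addr0 subrr add0r expr0n/= mul0r.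
rewrite -subr_ge0.
apply: (@nonneg_derive_ge0 _ (fun b => b ^+ J.+1 / J.+1`!%:R - (cos (a + b) - cos_taylor J.+1 a b))
  (fun x => x ^+ J / J`!%:R - (cos (a + pi / 2 + x) - cos_taylor J (a + pi / 2) x))) => //.
- by move=> x /(ih (a + pi / 2)); rewrite ler_norml => /andP[_]; lra.
- by rewrite cos_taylor0 addr0 subrr subr0 expr0n/= mul0r.
Qed.

End cos_taylor.

Lemma bin_leq_expn n m : ('C(n, m) <= 2 ^ n)%N.
Proof.
elim: n m => [|n ih] [|m] //; first by rewrite bin0 expn_gt0.
by rewrite binS expnS mul2n -addnn leq_add.
Qed.

Lemma cvg_natr_expr (R : realType) (r : R) : 0 <= r < 1 ->
  n%:R * r ^+ n @[n --> \oo] --> (0 : R).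
Proof.
move=> /andP[r0 r1]; have [->|rN0] := eqVneq r 0.
  apply: cvg_near_cst; exists 1%N => // n /= n1.
  by rewrite expr0n gtn_eqF// mulr0.
have rgt0 : 0 < r by rewrite lt_neqAle eq_sym rN0.
(* With [r = q ^ 2] and [1 / q = 1 + x], Bernoulli's inequality gives [n q ^ n <= 1 / x], and a
   second factor [q ^ n] remains to tend to 0. *)
pose q := Num.sqrt r; have q0 : 0 < q by rewrite sqrtr_gt0.
have q1 : q < 1 by rewrite -[ltRHS]sqrtr1 ltr_sqrt.
have qr : q ^+ 2 = r by rewrite sqr_sqrtr.
pose x := q^-1 - 1; have x0 : 0 < x by rewrite subr_gt0 invf_gt1.
apply: (@squeeze_cvgr _ _ _ _ (fun=> 0) (fun n => x^-1 * q ^+ n)).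
- apply: nearW => n; rewrite mulr_ge0 ?exprn_ge0//= -qr -exprM mul2n -addnn exprD mulrA.
  rewrite ler_pM2r ?exprn_gt0// -[x^-1]mul1r ler_pdivlMr//.
  have H : 1 + n%:R * x <= q^-1 ^+ n.
    elim: n => [|n ih]; first by rewrite mul0r addr0 expr0.
    have h : (1 + n%:R * x) * (1 + x) <= q^-1 ^+ n * (1 + x).
      by rewrite ler_pM2r// addr_gt0.
    have -> : q^-1 ^+ n.+1 = q^-1 ^+ n * (1 + x) by rewrite exprSr /x addrC subrK.
    apply: le_trans h; rewrite -natr1.
    have : 0 <= n%:R * x * x by rewrite !mulr_ge0// ltW.
    lra.
  rewrite exprVn in H.
  have qn : 0 < q ^+ n by rewrite exprn_gt0.
  rewrite -[leRHS](mulVf (lt0r_neq0 qn)) mulrAC ler_pM2r//; lra.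
- exact: cvg_cst.
- rewrite -[X in _ --> X](mulr0 x^-1); apply: cvgMr; apply: cvg_expr.
  by rewrite ger0_norm// ltW.
Qed.

(** * Functions with equal integrals under two measures *)

Section agree.
Context (R : realType) (mu nu : {measure set (measurableTypeR R) -> \bar R}).
Implicit Types (f g : R -> R) (t h y q : R).
Let D : set (measurableTypeR R) := `[0%R, +oo[%classic.
Let mD : measurable D. Proof. exact: measurable_half_line. Qed.

(** Integrability is included because additivity of the real-valued integral depends on it. *)
Definition same_integral f := [/\ mu.-integrable D (EFin \o f),
  nu.-integrable D (EFin \o f) & \int[mu]_(x in D) f x = \int[nu]_(x in D) f x].

Lemma eq_same_integral f g : (forall x, 0 <= x -> f x = g x) ->
  same_integral f -> same_integral g.
Proof.
move=> fg [imu inu e].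
have fgD x : x \in D -> f x = g x by rewrite inE /D/= in_itv/= andbT => /fg.
have eE x : x \in D -> (EFin \o f) x = (EFin \o g) x by move=> /fgD/= ->.
split; [exact: eq_integrable imu|exact: eq_integrable inu|].
by rewrite -(eq_Rintegral mu fgD) -(eq_Rintegral nu fgD).
Qed.

Lemma same_integralD f g : same_integral f -> same_integral g ->
  same_integral (fun x => f x + g x).
Proof.
move=> [f1 f2 fe] [g1 g2 ge]; split.
- by apply: eq_integrable (integrableD mD f1 g1).
- by apply: eq_integrable (integrableD mD f2 g2).
- by rewrite !RintegralD// fe ge.
Qed.

Lemma same_integralZ f c : same_integral f -> same_integral (fun x => c * f x).
Proof.
move=> [f1 f2 fe]; split.
- by apply: eq_integrable (integrableZl mD c f1).
- by apply: eq_integrable (integrableZl mD c f2).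
- by rewrite !RintegralZl// fe.
Qed.

Lemma same_integral0 : same_integral (fun=> 0).
Proof.
by split; [exact: integrable0|exact: integrable0|rewrite !Rintegral_cst// !mul0r].
Qed.

Lemma same_integral_sum n (F : nat -> R -> R) : (forall j, same_integral (F j)) ->
  same_integral (fun x => \sum_(j < n) F j x).
Proof.
move=> HF; elim: n => [|n ih].
  by apply: eq_same_integral same_integral0 => x _; rewrite big_ord0.
apply: eq_same_integral (same_integralD ih (HF n)) => x _.
by rewrite big_ord_recr.
Qed.

Lemma same_integral_lim f (f_ : nat -> R -> R) : same_integral (fun=> 1) ->
  (forall n, same_integral (f_ n)) ->
  (forall x, 0 <= x -> f_ n x @[n --> \oo] --> f x) ->
  (forall n x, 0 <= x -> `|f_ n x| <= 1) -> same_integral f.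
Proof.
move=> [i1 j1 _] Hf fl fb.
have mf_ n : measurable_fun D (f_ n).
  by case: (Hf n) => /integrableP[/measurable_EFinP].
have mf : measurable_fun D f.
  apply: (measurable_fun_cvg mf_) => x.
  by rewrite /D/= in_itv/= andbT; exact: fl.
have dct (xi : {measure set (measurableTypeR R) -> \bar R}) :
    xi.-integrable D (EFin \o (fun=> 1 : R)) ->
    (forall n, xi.-integrable D (EFin \o f_ n)) ->
    xi.-integrable D (EFin \o f) /\
    \int[xi]_(x in D) f_ n x @[n --> \oo] --> \int[xi]_(x in D) f x.
  move=> I1 If; have [|||||iF _ cF] := @dominated_convergence _ _ _ xi D mD
    (fun n => EFin \o f_ n) (EFin \o f) (EFin \o (fun=> 1 : R)) => //.
  - by move=> n; apply/measurable_EFinP.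
  - by apply/measurable_EFinP.
  - apply: aeW => x; rewrite /D/= in_itv/= andbT => x0.
    by apply: cvg_EFin; [exact: nearW|exact: fl].
  - apply: aeW => x n; rewrite /D/= in_itv/= andbT => x0.
    by rewrite lee_fin fb.
  split => //; apply: fine_cvg; rewrite fineK//; exact: integrable_fin_num.
have [||iF cF] := dct mu => //; first by move=> n; case: (Hf n).
have [||iG cG] := dct nu => //; first by move=> n; case: (Hf n).
split => //; have cFG : \int[mu]_(x in D) f_ n x @[n --> \oo] --> \int[nu]_(x in D) f x.
  by rewrite (_ : (fun n => _) = fun n => \int[nu]_(x in D) f_ n x)//; apply/funext => n; case: (Hf n).
exact: (cvg_unique _ cF cFG).
Qed.

(** Asking for all frequencies [t] makes the class stable under multiplication by
    [cos (h sqrt x)]. *)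
Definition same_cos_integral f :=
  forall t, same_integral (fun x => f x * cos (t * Num.sqrt x)).

Lemma eq_same_cos_integral f g : (forall x, 0 <= x -> f x = g x) ->
  same_cos_integral f -> same_cos_integral g.
Proof.
by move=> fg Hf t; apply: eq_same_integral (Hf t) => x /fg ->.
Qed.

Lemma same_cos_integralB f g : same_cos_integral f -> same_cos_integral g ->
  same_cos_integral (fun x => f x - g x).
Proof.
move=> Hf Hg t.
apply: eq_same_integral (same_integralD (Hf t) (same_integralZ (-1) (Hg t))) => x _; ring.
Qed.

(** This is [cos (h sqrt x / 2) ^ 2], the cosine moved into [[0, 1]], where [step_approx]
    applies. *)
Definition half_cos h x : R := (1 + cos (h * Num.sqrt x)) / 2.

Lemma half_cos_itv h x : 0 <= half_cos h x <= 1.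
Proof.
have := cos_geN1 (h * Num.sqrt x); have := cos_le1 (h * Num.sqrt x).
rewrite /half_cos; lra.
Qed.

Lemma same_cos_integralM_half_cos h n f : same_cos_integral f ->
  same_cos_integral (fun x => f x * half_cos h x ^+ n).
Proof.
move=> Hf; elim: n => [|n ih].
  by apply: eq_same_cos_integral Hf => x _; rewrite mulr1.
move=> t.
(* The product formula for [cos (t y) cos (h y)] turns one more factor [half_cos] into the
   frequencies [t], [t + h] and [t - h]. *)
apply: eq_same_integral (same_integralD (same_integralZ (1/2) (ih t))
  (same_integralD (same_integralZ (1/4) (ih (t + h)))
                  (same_integralZ (1/4) (ih (t - h))))) => x _.
have -> : half_cos h x ^+ n.+1 = half_cos h x ^+ n * ((1 + cos (h * Num.sqrt x)) / 2).
  by rewrite exprSr.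
rewrite mulrDl mulrBl cosD cosB.
by field.
Qed.

Lemma same_cos_integral_approx h n K : same_cos_integral (fun=> 1) ->
  same_cos_integral (fun x => (1 - half_cos h x ^+ n) ^+ K).
Proof.
move=> H1; elim: K => [|K ih]; first exact: H1.
apply: eq_same_cos_integral
  (same_cos_integralB ih (same_cos_integralM_half_cos h n ih)) => x _.
by rewrite exprSr; ring.
Qed.

(* [K_ n * u ^ n] tends to 0 for [u < q], and is at least [n] for [u >= q]. *)
Lemma step_approx q (K_ := fun n => (Num.truncn (n%:R * q ^- n)).+1) u : 0 < q <= 1 ->
  0 <= u <= 1 ->
  (1 - u ^+ n) ^+ K_ n @[n --> \oo] --> ((u < q)%R%:R : R).
Proof.
move=> /andP[q0 q1] /andP[u0 u1].
have un n : 0 <= u ^+ n <= 1 by rewrite exprn_ge0//= exprn_ile1.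
have qn n : 0 < q ^+ n by rewrite exprn_gt0.
have Kn n : n%:R * q ^- n <= (K_ n)%:R <= n%:R * q ^- n + 1.
  have nq : 0 <= n%:R * q ^- n by rewrite mulr_ge0// invr_ge0 ltW.
  have /andP[h1 h2] := truncn_itv nq.
  by rewrite (ltW h2)/= /K_ -natr1 lerD2r.
have [uq|qu] := ltP u q.
  have r01 : 0 <= u / q < 1 by rewrite divr_ge0 ?(ltW q0)//= ltr_pdivrMr// mul1r.
  have u1' : u < 1 by exact: lt_le_trans q1.
  have H : 1 - (n%:R * (u / q) ^+ n + u ^+ n) @[n --> \oo] --> (1 : R).
    rewrite -[X in _ --> X]subr0; apply: cvgB; first exact: cvg_cst.
    rewrite -[X in _ --> X]addr0; apply: cvgD; first exact: cvg_natr_expr.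
    by apply: cvg_expr; rewrite ger0_norm.
  apply: (squeeze_cvgr _ H (cvg_cst _)); apply: nearW => n.
  have /andP[un0 un1] := un n; apply/andP; split; last first.
    by rewrite exprn_ile1; lra.
  apply: (@le_trans _ _ (1 - (K_ n)%:R * u ^+ n)).
    have /andP[_ h] := Kn n; rewrite lerD2l lerN2 expr_div_n.
    by have := ler_wpM2r un0 h; rewrite mulrDl mul1r mulrAC mulrA.
  elim: (K_ n) => [|k ih]; first by rewrite mul0r subr0 expr0.
  rewrite exprSr.
  have h : (1 - k%:R * u ^+ n) * (1 - u ^+ n) <= (1 - u ^+ n) ^+ k * (1 - u ^+ n).
    by rewrite ler_wpM2r// subr_ge0.
  apply: le_trans h; rewrite -natr1.
  have : 0 <= k%:R * u ^+ n * u ^+ n by rewrite !mulr_ge0.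
  lra.
have H : expR (- n%:R) @[n --> \oo] --> (0 : R).
  apply: (@cvg_comp _ _ _ (fun n => n%:R) (fun x : R => expR (- x)) _ (pinfty_nbhs R)).
    exact: cvgr_idn.
  exact: cvgr_expR.
apply: (squeeze_cvgr _ (cvg_cst _) H); apply: nearW => n.
have /andP[un0 un1] := un n; rewrite exprn_ge0 ?subr_ge0//=.
apply: (@le_trans _ _ (expR (- u ^+ n) ^+ K_ n)).
  rewrite ler_pXn2r// ?nnegrE ?subr_ge0 ?expR_ge0//.
  exact: expR_ge1Dx.
rewrite -expRM_natl ler_expR mulrN lerN2.
have /andP[h _] := Kn n.
have uqn : q ^+ n <= u ^+ n by apply: lerXn2r; rewrite // nnegrE ltW.
have n0 : 0 <= n%:R * q ^- n by rewrite mulr_ge0// invr_ge0 ltW.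
have := ler_pM n0 (ltW (qn n)) h uqn.
by rewrite mulfVK// lt0r_neq0.
Qed.

Lemma same_integral_half_cos_lt h q : same_cos_integral (fun=> 1) -> 0 < q <= 1 ->
  same_integral (fun x => ((half_cos h x < q)%R%:R : R)).
Proof.
move=> H1 q01; have H0 f : same_cos_integral f -> same_integral f.
  by move=> /(_ 0); apply: eq_same_integral => x _; rewrite mul0r cos0 mulr1.
apply: (same_integral_lim (H0 _ H1) (fun n => H0 _ (same_cos_integral_approx h n
  (Num.truncn (n%:R * q ^- n)).+1 H1))) => [x _|n x _].
  by apply: step_approx => //; exact: half_cos_itv.
have /andP[u0 u1] := half_cos_itv h x.
have un : 0 <= 1 - half_cos h x ^+ n <= 1.
  by rewrite subr_ge0 exprn_ile1//= gerBl exprn_ge0.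
have /andP[v0 v1] := un.
by rewrite ger0_norm ?exprn_ge0// exprn_ile1.
Qed.

Lemma same_integral_tail b : same_cos_integral (fun=> 1) -> 0 <= b ->
  same_integral (fun x => ((b < x)%R%:R : R)).
Proof.
move=> H1 b0; pose a := Num.sqrt b; have a0 : 0 <= a := sqrtr_ge0 b.
(* The frequency is [h = 1 / M n]. The offset [N] keeps [a / M n] below [pi] for every [n], hence
   [q n > 0]. *)
pose N := Num.truncn (a / pi); pose M n : R := (N + n).+1%:R.
have pi0 := @pi_gt0 R.
have M0 n : 0 < M n by rewrite ltr0n.
have aM n : a / M n < pi.
  rewrite ltr_pdivrMr// mulrC -ltr_pdivrMr//.
  by rewrite (lt_le_trans (truncnS_gt _))// ler_nat ltnS leq_addr.
have aMin n : a / M n \in `[0, pi] by rewrite in_itv/= divr_ge0 ?(ltW (M0 n))//= ltW.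
pose q n : R := (1 + cos (a / M n)) / 2.
have q01 n : 0 < q n <= 1.
  have : -1 < cos (a / M n) by rewrite -cospi ltr_cos// in_itv/= lexx ltW.
  have := cos_le1 (a / M n); rewrite /q; lra.
apply: (same_integral_lim _ (fun n => same_integral_half_cos_lt (M n)^-1 H1 (q01 n))).
- by move: (H1 0); apply: eq_same_integral => x _; rewrite mul0r cos0 mulr1.
- move=> x x0; apply: cvg_near_cst.
  (* As soon as [y / M n < pi], both angles lie where the cosine decreases, and the indicator equals
     that of [b < x]: for fixed [x] the sequence is eventually constant. *)
  pose y := Num.sqrt x; have y0 : 0 <= y := sqrtr_ge0 x.
  exists (Num.truncn (y / pi)) => // n /= yn.
  have yM : y / M n < pi.
    rewrite ltr_pdivrMr// mulrC -ltr_pdivrMr//.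
    by rewrite (lt_le_trans (truncnS_gt _))// ler_nat ltnS (leq_trans yn)// leq_addl.
  have yMin : y / M n \in `[0, pi] by rewrite in_itv/= divr_ge0 ?(ltW (M0 n))//= ltW.
  rewrite /half_cos /q ltr_pM2r ?invr_gt0// ltrD2l mulrC ltr_cos//.
  rewrite ltr_pM2r ?invr_gt0// /a /y.
  have [xE|xN] := eqVneq x 0; last by rewrite ltr_sqrt// lt_neqAle eq_sym xN.
  by rewrite xE sqrtr0 !ltNge b0 sqrtr_ge0.
- by move=> n x _; case: ltP; rewrite ?normr1 ?normr0.
Qed.

Lemma same_tails : mu [set x : R | x < 0] = 0%E -> nu [set x : R | x < 0] = 0%E ->
  same_cos_integral (fun=> 1) ->
  forall A : set (measurableTypeR R), measurable A -> mu A = nu A.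
Proof.
move=> mu0 nu0 H1.
have mN : measurable [set x : measurableTypeR R | x < 0].
  by rewrite -[X in measurable X]set_itvE; exact: measurable_itv.
have fine_eq (B : set (measurableTypeR R)) : measurable B -> B `<=` D ->
    same_integral (fun x => \1_B x) -> (mu B = nu B) /\ (mu B < +oo)%E.
  move=> mB BD [i1 i2]; have BI : B `&` D = B by exact/setIidPl.
  have F1 := integrable_fin_num mD i1; have F2 := integrable_fin_num mD i2.
  have I (xi : {measure set (measurableTypeR R) -> \bar R}) :
    (\int[xi]_(x in D) (\1_B x)%:E = xi B)%E.
    by rewrite -[in RHS]BI; exact: integral_indic.
  rewrite /Rintegral; move: F1 F2; rewrite /= !I => F1 F2 fE.
  by split; [rewrite -(fineK F1) fE fineK|rewrite ltey_eq F1].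
have setTE (xi : {measure set (measurableTypeR R) -> \bar R}) :
    xi [set x : R | x < 0] = 0%E -> xi setT = xi D.
  move=> xi0; rewrite (_ : setT = [set x : measurableTypeR R | x < 0] `|` D).
    rewrite measureU//; first by rewrite [X in (X + _)%E](_ : _ = 0%E) ?add0e.
    apply/seteqP; split=> x //=; rewrite /D/= in_itv/= andbT => -[xN].
    by rewrite leNgt xN.
  apply/seteqP; split=> x //= _; rewrite /D/= in_itv/= andbT.
  by case: (leP 0 x); [right|left].
have [DE Doo] : mu D = nu D /\ (mu D < +oo)%E.
  apply: fine_eq => //; move: (H1 0); apply: eq_same_integral => x x0.
  by rewrite mul0r cos0 mulr1 indicE mem_set// /D/= in_itv/= andbT.
apply: measure_eq_tails => //; rewrite ?setTE// => b b0.
have [] // : mu `]b, +oo[%classic = nu `]b, +oo[%classic /\ (mu `]b, +oo[%classic < +oo)%E.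
apply: fine_eq; first exact: measurable_itv.
  by move=> x; rewrite /D/= !in_itv/= !andbT => /ltW/(le_trans b0).
apply: eq_same_integral (same_integral_tail H1 b0) => x x0.
by rewrite indicE mem_setE in_itv/= andbT.
Qed.

End agree.

(** * Taylor steps from factorial moment bounds *)

Section moment_bound.
Context (R : realType) (m : nat -> R) (mfact : forall n, m n <= (2 * n)`!%:R).
Implicit Types (xi mu nu : {measure set (measurableTypeR R) -> \bar R}) (t h : R).
Let D : set (measurableTypeR R) := `[0%R, +oo[%classic.
Let mD : measurable D. Proof. exact: measurable_half_line. Qed.

Lemma continuous_sqrt_pow_cos t (k : nat) a :
  continuous (fun x : R => Num.sqrt x ^+ k * cos (t * Num.sqrt x + a)).
Proof.
move=> x; have cs := @sqrt_continuous R x.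
apply: cvgM; first by apply: (@cvg_comp _ _ _ _ (fun y : R => y ^+ k) _ _ _ cs); exact: exprn_continuous.
apply: (cvg_comp (fun x => t * Num.sqrt x + a) cos _ (@continuous_cos R _)).
by apply: cvgD; [exact: cvgMr|exact: cvg_cst].
Qed.

Lemma measurable_sqrt_pow_cos t k a :
  measurable_fun D (fun x : R => Num.sqrt x ^+ k * cos (t * Num.sqrt x + a)).
Proof.
apply: within_continuous_measurable; apply: continuous_subspaceT.
exact: continuous_sqrt_pow_cos.
Qed.

Lemma represents_expn xi n : stieltjes_represents xi m ->
  xi.-integrable D (EFin \o (fun x => x ^+ n)) /\ \int[xi]_(x in D) x ^+ n = m n.
Proof.
move=> [_ xim]; rewrite /Rintegral xim; split=> //; apply/integrableP; split.
  apply/measurable_EFinP; apply: within_continuous_measurable.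
  by apply: continuous_subspaceT; exact: exprn_continuous.
rewrite (eq_integral (fun x : measurableTypeR R => ((x : R) ^+ n)%:E)) ?xim ?ltry// => x.
by rewrite inE /D/= in_itv/= andbT => x0; rewrite ger0_norm// exprn_ge0.
Qed.

(** Odd powers of [sqrt x] are not among the moments; they are enclosed between integer powers of
    [x] by [y <= 1 + y ^ 2]. *)
Lemma sqrt_expn_le (x : R) n : 0 <= x ->
  Num.sqrt x ^+ n <= x ^+ (n./2) + x ^+ (n./2 + odd n).
Proof.
move=> x0; have y0 := sqrtr_ge0 x; have yx := sqr_sqrtr x0.
set y := Num.sqrt x in y0 yx *.
rewrite -{1}(odd_double_half n) -muln2 exprD mulnC exprM yx.
case: (odd n); rewrite ?addn1 ?addn0 /= ?expr0 ?mul1r.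
  rewrite expr1 exprSr -{2}[x ^+ _]mulr1 -mulrDr mulrC ler_wpM2l ?exprn_ge0//.
  rewrite -yx; have := sqr_ge0 (y - 1); rewrite !expr2; lra.
by rewrite lerDl exprn_ge0.
Qed.

(** Both exponents of [sqrt_expn_le] are at most [(n + 1) / 2], so each of the two moments is at
    most [(n + 1)!]. *)
Lemma sqrt_expn_integral xi n : stieltjes_represents xi m ->
  xi.-integrable D (EFin \o (fun x => Num.sqrt x ^+ n)) /\
  \int[xi]_(x in D) Num.sqrt x ^+ n <= 2 * n.+1`!%:R.
Proof.
move=> xim; have [i1 e1] := represents_expn n./2 xim.
have [i2 e2] := represents_expn (n./2 + odd n) xim.
have i3 : xi.-integrable D (EFin \o (fun x => x ^+ (n./2) + x ^+ (n./2 + odd n))).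
  by apply: eq_integrable (integrableD mD i1 i2).
have i : xi.-integrable D (EFin \o (fun x => Num.sqrt x ^+ n)).
  apply: le_integrable i3 => //.
    apply/measurable_EFinP.
    have := measurable_sqrt_pow_cos 0 n 0.
    by under eq_fun do rewrite mul0r addr0 cos0 mulr1.
  move=> x; rewrite /D/= in_itv/= andbT => x0; rewrite lee_fin.
  rewrite ger0_norm ?exprn_ge0 ?sqrtr_ge0// (le_trans (sqrt_expn_le n x0))//.
  exact: ler_norm.
split => //.
apply: (@le_trans _ _ (\int[xi]_(x in D) (x ^+ (n./2) + x ^+ (n./2 + odd n)))).
  apply: le_Rintegral => // x; rewrite /D/= in_itv/= andbT; exact: sqrt_expn_le.
rewrite RintegralD// e1 e2 mulr2n mulrDl mul1r; apply: lerD.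
all: apply: (le_trans (mfact _)); rewrite ler_nat leq_fact//.
  by rewrite mul2n -[X in (_ <= X.+1)%N]odd_double_half ltnW// ltnS leq_addl.
rewrite mul2n doubleD -[X in (_ <= X.+1)%N]odd_double_half.
by rewrite addnC -addSn leq_add2r; case: (odd n).
Qed.

(** The [k]-th derivative of [cos (t sqrt x)] in [t]. All [k] are carried along, since a Taylor step
    at [t] uses every derivative there. *)
Definition sqrt_cos_moment t k (x : R) : R :=
  Num.sqrt x ^+ k * cos (t * Num.sqrt x + k%:R * (pi / 2)).

Lemma integrable_sqrt_cos_moment xi t k : stieltjes_represents xi m ->
  xi.-integrable D (EFin \o sqrt_cos_moment t k).
Proof.
move=> xim; have [i _] := sqrt_expn_integral k xim.
apply: le_integrable i => //.
  by apply/measurable_EFinP; exact: measurable_sqrt_pow_cos.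
move=> x _; rewrite lee_fin /sqrt_cos_moment normrM ler_piMr//.
exact: cos_max.
Qed.

Lemma sqrt_cos_moment_taylor t h k J (x : R) : 0 <= h ->
  `|sqrt_cos_moment (t + h) k x -
    \sum_(j < J) h ^+ j / j`!%:R * sqrt_cos_moment t (k + j) x| <=
  h ^+ J / J`!%:R * Num.sqrt x ^+ (k + J).
Proof.
move=> h0; have y0 := sqrtr_ge0 x.
have := @cos_taylor_bound R J (t * Num.sqrt x + k%:R * (pi / 2)) _ (mulr_ge0 h0 y0).
rewrite /sqrt_cos_moment /cos_taylor; move: (Num.sqrt x) y0 => y y0 H.
have yk : 0 <= y ^+ k by rewrite exprn_ge0.
have := ler_wpM2l yk H; rewrite -{1}(ger0_norm yk) -normrM mulrBr mulr_sumr.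
rewrite [t * y + _ + _]addrAC -mulrDl exprMn.
rewrite [X in _ <= X -> _](_ : _ = h ^+ J / J`!%:R * y ^+ (k + J)); last first.
  by rewrite exprD; ring.
congr (`|_ - _| <= _); apply: eq_bigr => j _.
have -> : t * y + (k + j)%:R * (pi / 2) = t * y + k%:R * (pi / 2) + j%:R * (pi / 2).
  by rewrite natrD; ring.
by rewrite exprMn exprD; move: (cos _) => C; ring.
Qed.

Context (mu nu : {measure set (measurableTypeR R) -> \bar R}).
Context (mum : stieltjes_represents mu m) (num : stieltjes_represents nu m).

Lemma same_integral_gap f p c n : 0 <= c ->
  mu.-integrable D (EFin \o f) -> nu.-integrable D (EFin \o f) ->
  same_integral mu nu p ->
  (forall x, 0 <= x -> `|f x - p x| <= c * Num.sqrt x ^+ n) ->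
  `|\int[mu]_(x in D) f x - \int[nu]_(x in D) f x| <= 4 * c * n.+1`!%:R.
Proof.
move=> c0 i1 i2 [j1 j2 pE] fp.
have gap xi : stieltjes_represents xi m -> xi.-integrable D (EFin \o f) ->
    xi.-integrable D (EFin \o p) ->
    `|\int[xi]_(x in D) f x - \int[xi]_(x in D) p x| <= c * (2 * n.+1`!%:R).
  move=> xim i j; have [k kb] := sqrt_expn_integral n xim.
  have ij : xi.-integrable D (EFin \o (fun x => f x - p x)).
    by apply: eq_integrable (integrableB mD i j).
  have kc : xi.-integrable D (EFin \o (fun x => c * Num.sqrt x ^+ n)).
    by apply: eq_integrable (integrableZl mD c k).
  rewrite -RintegralB//; apply: (le_trans (le_normr_Rintegral mD ij)).
  apply: le_trans (ler_wpM2l c0 kb); rewrite -RintegralZl//.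
  apply: le_Rintegral => //; first by have := integrable_norm ij.
  by move=> x; rewrite /D/= in_itv/= andbT; exact: fp.
have := gap _ mum i1 j1; have := gap _ num i2 j2; rewrite pE !ler_norml.
lra.
Qed.

(** At [t = 0] the cosine of [k] quarter turns kills the odd [k], and the even ones are multiples of
    moments. *)
Lemma same_integral_sqrt_cos_moment0 k : same_integral mu nu (sqrt_cos_moment 0 k).
Proof.
have sinjpi j : sin (j%:R * pi : R) = 0.
  elim: j => [|j ih]; first by rewrite mul0r sin0.
  by rewrite -natr1 mulrDl mul1r sinD ih sinpi mul0r mulr0 addr0.
have xn n : same_integral mu nu (fun x => x ^+ n).
  have [i1 e1] := represents_expn n mum; have [i2 e2] := represents_expn n num.
  by split => //; rewrite e1.
have [ko|ke] := boolP (odd k).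
  apply: eq_same_integral (same_integral0 mu nu) => x _.
  rewrite /sqrt_cos_moment mul0r add0r -(odd_double_half k) ko natrD mulrDl mul1r.
  rewrite [pi / 2 + _]addrC cosDpihalf (_ : _ * (pi / 2) = (k./2)%:R * pi).
    by rewrite sinjpi oppr0 mulr0.
  by rewrite -mul2n natrM; field.
apply: eq_same_integral (same_integralZ (cos (k%:R * (pi / 2))) (xn k./2)) => x x0.
rewrite /sqrt_cos_moment mul0r add0r mulrC; congr (_ * _).
rewrite -[in RHS](odd_double_half k) (negbTE ke) add0n -mul2n exprM.
by rewrite sqr_sqrtr.
Qed.

(** The Taylor polynomials have equal integrals under [mu] and [nu], and the remainders contribute
    at most a constant times [(2 h) ^ J]. With [h <= 1 / 4] this is at most a constant times
    [2 ^ (- J)], whatever [t] is. *)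
Lemma same_integral_sqrt_cos_moment_step t h : 0 <= h <= 1 / 4 ->
  (forall k, same_integral mu nu (sqrt_cos_moment t k)) ->
  forall k, same_integral mu nu (sqrt_cos_moment (t + h) k).
Proof.
move=> /andP[h0 h4] Ht k.
have i1 := integrable_sqrt_cos_moment (t + h) k mum.
have i2 := integrable_sqrt_cos_moment (t + h) k num.
split => //; apply/eqP; rewrite -subr_eq0 -normr_le0.
set d := `|_|.
suff H : forall J, d <= 4 * k.+1`!%:R * 2 ^+ k.+1 * (2^-1) ^+ J.
  have H0 : 4 * k.+1`!%:R * 2 ^+ k.+1 * (2^-1) ^+ J @[J --> \oo] --> (0 : R).
    rewrite -[X in _ --> X](mulr0 (4 * k.+1`!%:R * 2 ^+ k.+1)); apply: cvgMr.
    by apply: cvg_expr; rewrite ger0_norm; lra.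
  by apply: (cvgr_to_ge H0); apply: nearW.
move=> J.
have c0 : 0 <= h ^+ J / J`!%:R by rewrite divr_ge0// exprn_ge0.
have pS : same_integral mu nu
    (fun x => \sum_(j < J) h ^+ j / j`!%:R * sqrt_cos_moment t (k + j) x).
  apply: (@same_integral_sum R mu nu J
    (fun j x => h ^+ j / j`!%:R * sqrt_cos_moment t (k + j) x)) => j.
  exact: same_integralZ.
apply: (le_trans (same_integral_gap c0 i1 i2 pS _)).
  by move=> x _; exact: sqrt_cos_moment_taylor.
have h4J : h ^+ J <= (2^-1) ^+ J * (2^-1) ^+ J.
  rewrite -exprMn; apply: lerXn2r; rewrite ?nnegrE; lra.
have Jf : 0 < J`!%:R :> R by rewrite ltr0n fact_gt0.
(* The binomial coefficient of [k + J + 1] over [J] is at most [2 ^ (k + J + 1)]; the factor [J!]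
   cancels the one of the Taylor remainder. *)
have H : (k + J).+1`!%:R <= (2 ^+ k.+1 * 2 ^+ J) * (J`!%:R * k.+1`!%:R) :> R.
  rewrite -exprD addSn -natrX -!natrM ler_nat -(@bin_fact (k + J).+1 J); last first.
    by rewrite -addSn leq_addl.
  by rewrite -addSn addnK leq_mul// bin_leq_expn.
have kf : 0 <= k.+1`!%:R :> R by [].
have P0 : 0 <= 4 * (h ^+ J / J`!%:R) by rewrite mulr_ge0.
apply: (le_trans (ler_wpM2l P0 H)).
have -> : 4 * (h ^+ J / J`!%:R) * (2 ^+ k.+1 * 2 ^+ J * (J`!%:R * k.+1`!%:R)) =
    (4 * k.+1`!%:R * 2 ^+ k.+1) * (h ^+ J * 2 ^+ J).
  by move: (k.+1`!%:R) (J`!%:R) Jf => A B B0; field; exact: lt0r_neq0.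
rewrite ler_wpM2l ?mulr_ge0 ?exprn_ge0//.
have p2 : 0 <= 2 ^+ J :> R by rewrite exprn_ge0.
apply: (le_trans (ler_wpM2r p2 h4J)).
by rewrite -!exprMn mulfVK.
Qed.

Lemma represents_same_cos : same_cos_integral mu nu (fun=> 1).
Proof.
have H t : 0 <= t -> forall k, same_integral mu nu (sqrt_cos_moment t k).
  move=> t0; pose n := (Num.truncn (4 * t)).+1.
  have n0 : 0 < n%:R :> R by rewrite ltr0n.
  have tn : 0 <= t / n%:R <= 1 / 4.
    rewrite divr_ge0//= ler_pdivrMr//.
    have := @truncnS_gt R (4 * t); rewrite -/n; lra.
  rewrite -[t](divfK (lt0r_neq0 n0)); move: (t / n%:R) tn => h h4.
  elim: (n) => [|j ih]; first by rewrite mulr0; exact: same_integral_sqrt_cos_moment0.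
  by rewrite -natr1 mulrDr mulr1; exact: same_integral_sqrt_cos_moment_step.
move=> t; wlog t0 : t / 0 <= t.
  move=> W; have [/W//|t0] := leP 0 t.
  have := W (- t); rewrite oppr_ge0 (ltW t0) => /(_ isT).
  by apply: eq_same_integral => x _; rewrite mulNr cosN.
apply: eq_same_integral (H t t0 0%N) => x _.
by rewrite /sqrt_cos_moment mul0r addr0.
Qed.

End moment_bound.

Lemma moment_bound_unique (R : realType) (m : nat -> R)
    (mu nu : {measure set (measurableTypeR R) -> \bar R}) :
  (forall n, m n <= (2 * n)`!%:R) ->
  stieltjes_represents mu m -> stieltjes_represents nu m ->
  forall A : set (measurableTypeR R), measurable A -> mu A = nu A.
Proof.
move=> mb mum num; apply: (same_tails mum.1 num.1).
exact: (represents_same_cos mb).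
Qed.

(** * Non-uniqueness *)

Lemma powRS (R : realType) (v p : R) : 0 <= p -> 0 <= v -> v `^ (p + 1) = v `^ p * v.
Proof.
move=> p0; rewrite le_eqVlt => /predU1P[<-|v0].
  by rewrite mulr0 powR0// gt_eqF// ltr_wpDl.
by rewrite powRD ?(gt_eqF v0) ?implybT// powRr1// ltW.
Qed.

Lemma is_derive0_eq (R : realType) (F : R -> R) (a b : R) : a <= b ->
  (forall x, x \in `[a, b] -> is_derive x (1 : R) F 0) -> F b = F a.
Proof.
move=> ab dF; have cF : {within `[a, b], continuous F}.
  by apply: derivable_within_continuous => x /dF[].
have dF' x : x \in `]a, b[ -> is_derive x 1 F ((fun=> 0) x).
  by move=> xab; apply: dF; exact: subset_itv_oo_cc xab.
have [c _ /eqP] := MVT_segment ab dF' cF.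
by rewrite mul0r subr_eq0 => /eqP.
Qed.

(** * Rotation of the ray in the gamma integral *)

Section gamma_rotation.
Context (R : realType) (p : R) (p0 : 0 <= p).
Implicit Types (v t d r : R).
Let mu := @lebesgue_measure R.
Let H : set (measurableTypeR R) := `[0%R, +oo[%classic.
Let mH : measurable H. Proof. exact: measurable_half_line. Qed.
Let p1 : 0 <= p + 1. Proof. by rewrite addr_ge0. Qed.

Let w t q v := v `^ q * expR (- (cos t * v)).

Let phase t d v := v * sin t - (p + 1) * t + d.

(** Real part of [exp (i d)] times the integrand of [Gamma (p + 1)] along the ray of argument [- t].
    That its integral does not depend on [t] is Cauchy's theorem, obtained here by differentiating
    under the integral sign. *)
Let rot d t v := w t p v * cos (phase t d v).

Let drot d t v := w t (p + 1) v * (sin t * cos (phase t d v) - cos t * sin (phase t d v))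
  + (p + 1) * w t p v * sin (phase t d v).

Let w_le t r q v : 0 <= v -> cos r <= cos t -> 0 <= w t q v <= w r q v.
Proof.
move=> v0 rt; rewrite mulr_ge0 ?powR_ge0 ?expR_ge0//=.
by rewrite ler_wpM2l ?powR_ge0// ler_expR lerN2 ler_wpM2r.
Qed.

Let continuous_phase t d : continuous (phase t d).
Proof.
by move=> v; apply: cvgD; [apply: cvgB; [exact: cvgMl|exact: cvg_cst]|exact: cvg_cst].
Qed.

Let continuous_cos_phase t d : continuous (cos \o phase t d).
Proof. by move=> v; apply: continuous_comp; [exact: continuous_phase|exact: continuous_cos]. Qed.

Let continuous_sin_phase t d : continuous (sin \o phase t d).
Proof. by move=> v; apply: continuous_comp; [exact: continuous_phase|exact: continuous_sin]. Qed.

Let w_continuous t q : 0 <= q -> {within `[0, +oo[, continuous (w t q)}.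
Proof. exact: powR_expR_continuous. Qed.

Let rot_continuous d t : {within `[0, +oo[, continuous (rot d t)}.
Proof.
move=> v; apply: cvgM; first exact: w_continuous.
by apply: continuous_subspaceT; exact: continuous_cos_phase.
Qed.

Let drot_continuous d t : {within `[0, +oo[, continuous (drot d t)}.
Proof.
move=> v; apply: cvgD; apply: cvgM.
- exact: w_continuous.
- apply: cvgB; apply: cvgMr; apply: continuous_subspaceT.
    exact: continuous_cos_phase.
  exact: continuous_sin_phase.
- by apply: cvgMr; exact: w_continuous.
- by apply: continuous_subspaceT; exact: continuous_sin_phase.
Qed.

Let dom r v := 2 * w r (p + 1) v + (p + 1) * w r p v.

Let drot_le r d t v : 0 <= v -> cos r <= cos t -> `|drot d t v| <= dom r v.
Proof.
move=> v0 rt; have /andP[w0 wr] := w_le p v0 rt.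
have /andP[w10 w1r] := w_le (p + 1) v0 rt.
apply: (le_trans (ler_normD _ _)); apply: lerD.
  rewrite mulrC normrM (ger0_norm w10); apply: ler_pM => //.
  apply: (le_trans (ler_normB _ _)); rewrite -[2]/(1 + 1); apply: lerD.
    by rewrite normrM mulr_ile1// ?sin_max ?cos_max.
  by rewrite normrM mulr_ile1// ?sin_max ?cos_max.
rewrite -mulrA normrM (ger0_norm p1) ler_wpM2l// (le_trans _ wr)//.
by rewrite normrM (ger0_norm w0) ler_piMr// sin_max.
Qed.

Let is_derive_rot d t v : 0 <= v -> is_derive t (1 : R) (fun t => rot d t v) (drot d t v).
Proof.
move=> v0; have dP : is_derive t (1 : R) (fun t => phase t d v) (v * cos t - (p + 1)).
  apply: is_derive_eq; rewrite /GRing.scale/=; ring.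
have dC : is_derive t (1 : R) (fun t => cos (phase t d v))
    (- sin (phase t d v) * (v * cos t - (p + 1))).
  exact: (@is_derive1_comp R cos (fun t => phase t d v)).
have dE : is_derive t (1 : R) (fun t => expR (- (cos t * v))) (v * sin t * expR (- (cos t * v))).
  apply: is_derive_eq; rewrite /GRing.scale/=; ring.
have -> : (fun t => rot d t v) =
    (fun t => v `^ p * (expR (- (cos t * v)) * cos (phase t d v))).
  by apply/funext => z; rewrite /rot /w mulrA.
have := is_deriveZ (v `^ p) (is_deriveM dE dC).
rewrite /GRing.scale/= [X in is_derive _ _ _ X -> _](_ : _ = drot d t v)//.
rewrite /drot /w powRS//; move: (expR _) (cos (phase t d v)) => e c; ring.
Qed.

(* The derivative of [rot] in [t] is a derivative in [v], so its integral
   vanishes. *)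
Let is_derive_prim d t v : 0 < v ->
  is_derive v (1 : R) (fun v => w t (p + 1) v * sin (phase t d v)) (drot d t v).
Proof.
move=> v0.
have dP : is_derive v (1 : R) (fun v => phase t d v) (sin t).
  apply: is_derive_eq; rewrite /GRing.scale/=; ring.
have dS : is_derive v (1 : R) (fun v => sin (phase t d v)) (cos (phase t d v) * sin t).
  exact: (@is_derive1_comp R sin (fun v => phase t d v)).
have dX := is_derive_powR (p + 1) v0; rewrite addrK in dX.
have dE : is_derive v (1 : R) (fun v => expR (- (cos t * v))) (- cos t * expR (- (cos t * v))).
  apply: is_derive_eq; rewrite /GRing.scale/=; ring.
have := is_deriveM (is_deriveM dX dE) dS.
rewrite /GRing.scale/= [X in is_derive _ _ _ X -> _](_ : _ = drot d t v)//.
rewrite /drot /w !mulrfctE; move: (expR _) (cos (phase t d v)) => e c; ring.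
Qed.

Let integral_drot d t : 0 < cos t -> \int[mu]_(v in H) drot d t v = 0.
Proof.
move=> c0; have c2 : 0 < cos t / 2 by rewrite divr_gt0.
have [C C0 HC] := powR_expR_dominated c0 p0.
have [C1 C10 HC1] := powR_expR_dominated c0 p1.
have w0 q v : 0 <= v -> `|w t q v| = w t q v.
  by move=> v0; rewrite ger0_norm// mulr_ge0 ?powR_ge0 ?expR_ge0.
transitivity (0 - w t (p + 1) 0 * sin (phase t d 0)); last first.
  by rewrite /w powR0 ?mul0r ?subr0// gt_eqF// ltr_wpDl.
apply: (@expR_dominated_FTC _ (drot d t) (fun v => w t (p + 1) v * sin (phase t d v))
  (2 * C1 + (p + 1) * C) (cos t / 2) 0).
- by [].
- exact: drot_continuous.
- move=> v v0; apply: (le_trans (drot_le _ v0 (lexx _))).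
  have := HC _ v0; have := HC1 _ v0; rewrite -/(w t p v) -/(w t (p + 1) v) !w0// => h1 h2.
  have := ler_wpM2l p1 h2; rewrite /dom.
  move: (w t (p + 1) v) (w t p v) (expR _) h1 {h2} => x y e h1 h2; lra.
- apply: norm_cvg0; apply: (@squeeze_cvgr _ _ _ _ (fun=> 0) (w t (p + 1))).
  + near=> v; have v0 : 0 <= v by near: v; exact: nbhs_pinfty_ge.
    by rewrite normr_ge0/= normrM w0// ler_piMr ?sin_max// -w0.
  + exact: cvg_cst.
  + exact: powR_expR_to0.
- by move=> v; exact: is_derive_prim.
- apply: cvgM; last by apply: cvg_at_right_filter; exact: continuous_sin_phase.
  apply: cvgM; first exact: powR_at_right0.
  by apply: cvg_at_right_filter; exact: continuous_expRM.
Unshelve. all: by end_near. Qed.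

Lemma gamma_int_rotation t : 0 <= t < pi / 2 ->
  \int[mu]_(v in H) (v `^ p * expR (- (cos t * v)) * sin (v * sin t)) =
  gamma_int 1 p * sin ((p + 1) * t).
Proof.
move=> /andP[t0 tpi]; have pi0 := @pi_gt0 R.
(* With this [d] the cosine becomes [sin (v sin t)] at angle [t] and the constant [sin ((p + 1) t)]
   at angle 0. *)
pose d := (p + 1) * t - pi / 2; pose F x := \int[mu]_(v in H) rot d x v.
have H0 v : H v -> 0 <= v by rewrite /H/= in_itv/= andbT.
(* Any [r] strictly between [t] and [pi / 2] would do: []-r, r[] is an open neighbourhood of
   [[0, t]] on which [cos x >= cos r > 0], so one dominating function serves the whole interval. *)
pose r := (t + pi / 2) / 2.
have rE : [/\ t < r, 0 < r & r < pi / 2] by rewrite /r; split; lra.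
have [tr r0 rpi] := rE.
have c0 : 0 < cos r by rewrite cos_gt0_pihalf//; lra.
have cr x : `]- r, r[%classic x -> cos r <= cos x.
  rewrite /= in_itv/= => xr.
  wlog x0 : x xr / 0 <= x.
    move=> W; have [/W|x0] := leP 0 x; first exact.
    by rewrite -(cosN x) W//; lra.
  by rewrite ltW// ltr_cos ?in_itv//=; lra.
have intF x : `]- r, r[%classic x -> mu.-integrable H (EFin \o rot d x).
  move=> xr; have c1 : 0 < cos x := lt_le_trans c0 (cr _ xr).
  have [C C0 HC] := powR_expR_dominated c1 p0.
  apply: (integrable_expR_dominated _ (@rot_continuous d x) (D := C) (a := cos x / 2)).
    by rewrite divr_gt0.
  move=> v v0; apply: le_trans (HC v v0); rewrite normrM ler_piMr//.
  exact: cos_max.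
have dF x : `]- r, r[%classic x -> is_derive x (1 : R) F 0.
  move=> xr.
  have derf z v : `]- r, r[%classic z -> H v -> derivable (fun t => rot d t v) z 1.
    by move=> _ /H0/(is_derive_rot d z)/@ex_derive.
  have dE z v : H v -> partial1of2 (rot d) z v = drot d z v.
    move=> /H0/(is_derive_rot d z) D.
    by rewrite /partial1of2 derive1E; apply: derive_val.
  have dom0 v : 0 <= dom r v.
    by rewrite addr_ge0 ?mulr_ge0 ?powR_ge0 ?expR_ge0.
  have idom : mu.-integrable H (EFin \o dom r).
    have i0 := integrable_gamma_int c0 p0; have i1 := integrable_gamma_int c0 p1.
    by apply: eq_integrable (integrableD mH (integrableZl mH 2 i1) (integrableZl mH (p + 1) i0)).
  have dom_ub z v : `]- r, r[%classic z -> H v -> `|partial1of2 (rot d) z v| <= dom r v.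
    by move=> zr Hv; rewrite dE// drot_le// ?H0// cr.
  apply: DeriveDef.
    exact: (@derivable_under_integral R _ _ mu (rot d) H mH x (- r) r xr intF derf _ dom0 idom dom_ub).
  rewrite -derive1E (@differentiation_under_integral R _ _ mu (rot d) H mH x (- r) r xr intF derf _ dom0 idom dom_ub).
  rewrite -[RHS](@integral_drot d x (lt_le_trans c0 (cr _ xr))).
  by apply: eq_Rintegral => v; rewrite inE => /dE <-.
have FE : F t = F 0.
  have st x : x \in `[0, t] -> `]- r, r[%classic x.
    by rewrite /= !in_itv/=; lra.
  exact: (is_derive0_eq t0 (fun x xt => dF x (st x xt))).
have -> : \int[mu]_(v in H) (v `^ p * expR (- (cos t * v)) * sin (v * sin t)) = F t.
  apply: eq_Rintegral => v _; rewrite /rot /phase /d.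
  by rewrite [in RHS]addrA subrK cosBpihalf.
rewrite FE /F /gamma_int mulrC -RintegralZl//; last exact: integrable_gamma_int.
apply: eq_Rintegral => v _; rewrite /rot /phase /d /w sin0 cos0 !mulr0 subr0 add0r.
by rewrite cosBpihalf mulrC.
Qed.

End gamma_rotation.

Lemma ge0_integral_mrestr (R : realType) d (T : measurableType d)
    (mu : {measure set T -> \bar R}) (D : set T) (mD : measurable D) (f : T -> \bar R) :
  measurable_fun setT f -> (forall x, 0 <= f x)%E ->
  (\int[mrestr mu mD]_x f x = \int[mu]_(x in D) f x)%E.
Proof.
move=> mf f0; rewrite (@ge0_negligible_integral _ _ _ _ setT (~` D))//; last 2 first.
- exact: measurableC.
- by transitivity (mu (~` D `&` D)); rewrite // setICl measure0.
rewrite setTD setCK; apply: eq_measure_integral => A mA AD.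
by rewrite /= /mrestr setIidl.
Qed.

(* The variable is a power of the abscissa of a uniform point below the graph of
   [f]. *)
Lemma mellin_fun_density (R : realType) (f phi : R -> R) (b : R) :
  measurable_fun [set: measurableTypeR R] f -> (forall v, 0 <= f v) -> phi 0 = 1 ->
  (forall s, 0 <= s ->
    (\int[lebesgue_measure]_(v in `[0%R, +oo[) (v `^ (b * s) * f v)%:E = (phi s)%:E)%E) ->
  mellin_fun phi.
Proof.
move=> mf f0 phi0 Hphi.
pose H : set (measurableTypeR R) := `[0%R, +oo[%classic.
have mH : measurable H by exact: measurable_half_line.
pose S : set (measurableTypeR R * measurableTypeR R) :=
  [set w | (0 <= w.1) && (0 <= w.2) && (w.2 < f w.1)].
have m1 : measurable_fun setT (fun w : measurableTypeR R * measurableTypeR R => w.1).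
  exact: measurable_fst.
have m2 : measurable_fun setT (fun w : measurableTypeR R * measurableTypeR R => w.2).
  exact: measurable_snd.
have mS : measurable S.
  have mb : measurable_fun setT (fun w : measurableTypeR R * measurableTypeR R =>
      (0 <= w.1) && (0 <= w.2) && (w.2 < f w.1)).
    apply: measurable_and; first apply: measurable_and.
    - by apply: measurable_fun_ler => //; exact: measurable_cst.
    - by apply: measurable_fun_ler => //; exact: measurable_cst.
    - by apply: measurable_fun_ltr => //; exact: (measurableT_comp mf).
  by rewrite -[S]setTI; exact: mb.
pose M := (lebesgue_measure \x lebesgue_measure)%E :
  {measure set (measurableTypeR R * measurableTypeR R) -> \bar R}.
(* The fibre of [S] over [v >= 0] has length [f v], so the first coordinate has density [f]. *)
have key (g : R -> R) : measurable_fun [set: measurableTypeR R] g -> (forall x, 0 <= g x) ->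
    (\int[mrestr M mS]_w (g w.1)%:E = \int[lebesgue_measure]_(v in H) (g v * f v)%:E)%E.
  move=> mg g0; have mg1 : measurable_fun setT
      (fun w : measurableTypeR R * measurableTypeR R => g w.1) by exact: (measurableT_comp mg).
  rewrite ge0_integral_mrestr; last 2 first.
  - exact/measurable_EFinP.
  - by move=> w; rewrite lee_fin.
  rewrite integral_mkcond (_ : _ \_ S = EFin \o (fun w => g w.1 * \1_S w)); last first.
    apply/funext => w; rewrite patchE /= indicE.
    by case: ifPn => _; rewrite ?mulr1 ?mulr0.
  rewrite fubini_tonelli1; last 2 first.
  - apply/measurable_EFinP; apply: measurable_funM => //.
  - by move=> w; rewrite lee_fin mulr_ge0.
  rewrite [RHS]integral_mkcond; apply: eq_integral => v _.
  rewrite /fubini_F/=.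
  under eq_integral do rewrite EFinM.
  pose A : set (measurableTypeR R) := if 0 <= v then `[0, f v[%classic else set0.
  have mA : measurable A by rewrite /A; case: ifP => // _; exact: measurable_itv.
  have SA y : \1_S (v, y) = \1_A y :> R.
    have E : ((v, y) \in S) = (y \in A).
      apply/idP/idP; rewrite !inE /S /A/=.
        by move=> /andP[/andP[-> y0] yf]; rewrite /= in_itv/= y0.
      by case: ifP => //=; rewrite in_itv.
    by rewrite !indicE E.
  transitivity (\int[lebesgue_measure]_y ((g v)%:E * (\1_A y)%:E))%E.
    by apply: eq_integral => y _; rewrite SA.
  rewrite ge0_integralZl// ?lee_fin//; last first.
    by apply/measurable_EFinP; exact: measurable_indic.
  rewrite integral_indic// setIT patchE /A /H.
  have [v0|v0] := leP 0 v; last by rewrite memNset ?measure0 ?mule0//= in_itv/= andbT leNgt v0.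
  rewrite mem_set/= ?in_itv/= ?v0// EFinM; congr (_ * _)%E.
  rewrite lebesgue_measure_itv/= lte_fin.
  case: ltP => fv; first by rewrite sube0.
  by congr (_%:E); apply/eqP; rewrite eq_le f0 fv.
pose P0 : {measure set (measurableTypeR R * measurableTypeR R) -> \bar R} := mrestr M mS.
have PT : P0 setT = 1%E.
  have := key (fun=> 1); rewrite integral_cst// mul1e => ->//.
  transitivity (phi 0)%:E; last by rewrite phi0.
  rewrite -Hphi//; apply: eq_integral => v _.
  by rewrite mulr0 powRr0.
pose P : probability (measurableTypeR R * measurableTypeR R)%type R :=
  HB.pack (Measure.sort P0) (Measure_isProbability.Build _ _ _ P0 PT).
exists _, (measurableTypeR R * measurableTypeR R)%type, P, (fun w => w.1 `^ b).
split=> [|w|s s0].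
- exact: measurable_fun_powR.
- exact: powR_ge0.
transitivity (\int[mrestr M mS]_w ((w.1 `^ b) `^ s)%:E)%E => //.
rewrite (key (fun v => (v `^ b) `^ s)).
- by rewrite -(Hphi _ s0); apply: eq_integral => v _; rewrite -powRrM.
- by apply: measurable_fun_powR; exact: measurable_powR.
- by move=> v; exact: powR_ge0.
Qed.

(** With [q = b - 1 + b s], the relation [b t = pi] gives [(q + 1) t = pi s + pi]. The sine term
    thus contributes a multiple of [sin (pi s)], which vanishes at the integers. *)
Lemma mellin_fun_sine (R : realType) (b t : R) : 1 < b -> 0 <= t < pi / 2 -> b * t = pi ->
  mellin_fun (fun s => (gamma_int (cos t) (b - 1 + b * s) -
    gamma_int 1 (b - 1 + b * s) * sin (pi * s)) / gamma_int (cos t) (b - 1)).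
Proof.
move=> b1 t01 bt; have /andP[t0 tpi] := t01.
have b0 : 0 <= b - 1 by rewrite subr_ge0 ltW.
have k0 : 0 < cos t by apply: cos_gt0_pihalf; have := @pi_gt0 R; lra.
set k := cos t in k0 *; set G := gamma_int k (b - 1).
have G0 : 0 < G := gamma_int_gt0 k0 b0.
pose H : set (measurableTypeR R) := `[0%R, +oo[%classic.
have mH : measurable H by exact: measurable_half_line.
have csin : continuous (fun v : R => sin (v * sin t)).
  by move=> v; apply: (cvg_comp (fun v : R => v * sin t) sin _ (@continuous_sin R _)); exact: cvgMl.
pose f (v : R) := G^-1 * (v `^ (b - 1) * expR (- (k * v)) * (1 + sin (v * sin t))).
apply: (@mellin_fun_density R f _ b).
- apply: measurable_funM; first exact: measurable_cst.
  apply: measurable_funM; first apply: measurable_funM.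
  + exact: measurable_powR.
  + by apply: continuous_measurable_fun; exact: continuous_expRM.
  + apply: measurable_funD; first exact: measurable_cst.
    exact: continuous_measurable_fun.
- move=> v; have s1 : 0 <= 1 + sin (v * sin t) by have := sin_geN1 (v * sin t); lra.
  by rewrite mulr_ge0 ?invr_ge0 ?(ltW G0)// mulr_ge0 ?mulr_ge0 ?powR_ge0 ?expR_ge0.
- by rewrite !mulr0 sin0 mulr0 subr0 addr0 divff// lt0r_neq0.
move=> s s0; have bs : 0 <= b * s by rewrite mulr_ge0// ltW// (lt_trans ltr01).
set q := b - 1 + b * s; have q0 : 0 <= q by rewrite addr_ge0.
have i1 := integrable_gamma_int k0 q0.
have i2 : lebesgue_measure.-integrable H
    (EFin \o (fun v => v `^ q * expR (- (k * v)) * sin (v * sin t))).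
  have [C C0 HC] := powR_expR_dominated k0 q0.
  apply: (@integrable_expR_dominated R _ C (k / 2)).
  - by rewrite divr_gt0.
  - move=> v; apply: cvgM; first exact: powR_expR_continuous.
    exact: continuous_subspaceT.
  - by move=> v v0; apply: le_trans (HC v v0); rewrite normrM ler_piMr// sin_max.
have i3 : lebesgue_measure.-integrable H (EFin \o (fun v => G^-1 *
    (v `^ q * expR (- (k * v)) + v `^ q * expR (- (k * v)) * sin (v * sin t)))).
  by apply: eq_integrable (integrableZl mH G^-1 (integrableD mH i1 i2)).
transitivity (\int[lebesgue_measure]_(v in H) (G^-1 *
    (v `^ q * expR (- (k * v)) + v `^ q * expR (- (k * v)) * sin (v * sin t)))%:E)%E.
  apply: eq_integral => v; rewrite inE/= in_itv/= andbT => v0.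
  congr (_%:E); rewrite /f.
  have -> : v `^ q = v `^ (b * s) * v `^ (b - 1).
    by rewrite -powRD addrC// gt_eqF//; lra.
  ring.
rewrite -(fineK (integrable_fin_num mH i3)); congr (_%:E).
rewrite -/(Rintegral _ _ _) RintegralZl//; last by apply: eq_integrable (integrableD mH i1 i2).
rewrite RintegralD// -/(gamma_int k q) gamma_int_rotation//.
have -> : (q + 1) * t = pi * s + pi by rewrite -bt /q; ring.
rewrite sinDpi; move: (gamma_int _ _) (gamma_int _ _) (sin _) => x y z; ring.
Qed.

(** * Interlacing poles and zeros *)

Lemma prod_divn (R : realType) p n (f : nat -> R) : (0 < p)%N ->
  \prod_(m < p * n) f (m %/ p)%N = \prod_(j < n) f j ^+ p.
Proof.
move=> p0; elim: n => [|n ih]; first by rewrite muln0 !big_ord0.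
rewrite mulnS addnC big_split_ord/= ih big_ord_recr/=; congr (_ * _).
under eq_bigr => i _.
  rewrite mulnC divnMDl// divn_small// addn0.
  over.
by rewrite prodr_const card_ord.
Qed.

Lemma cvg_mulnl (q : nat) : (0 < q)%N -> (q * n)%N @[n --> \oo] --> \oo.
Proof.
move=> q0 A [M _ HM]; exists M => // n /= Mn; apply: HM => /=.
by rewrite (leq_trans Mn)// leq_pmull.
Qed.

(** With [r = p / q], the numerator has poles at [- (1 + j) / 2] of order [r], and the reciprocal
    gamma integral has simple zeros at [- (1 + i / b)]. Cut into pieces of order [1 / q], the [m]-th
    pole is [- K m / 2] and the [m]-th zero is [- B m / 2], and each pair is a power of a
    [pole_ratio]. *)
Lemma mellin_fun_gamma_quotient (R : realType) (k : R) (p q : nat)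
    (b := 2 * (p%:R / q%:R) : R) : 0 < k -> (0 < q)%N -> (q <= p)%N ->
  mellin_fun (fun s => gamma_int 1 (2 * s) `^ (p%:R / q%:R) *
    (gamma_int k (b - 1) / gamma_int k (b - 1 + b * s))).
Proof.
move=> k0 q0 qp; have p0 : (0 < p)%N := leq_trans q0 qp.
have Q0 : 0 < q%:R :> R by rewrite ltr0n.
have P0 : 0 < p%:R :> R by rewrite ltr0n.
have r1 : 1 <= p%:R / q%:R :> R by rewrite ler_pdivlMr// mul1r ler_nat.
have b1 : 0 <= b - 1 by rewrite /b; lra.
have bp : 0 < b by lra.
pose K m : R := 1 + (m %/ p)%:R; pose B m : R := 2 + (m %/ q)%:R * (q%:R / p%:R).
have K0 m : 0 < K m by rewrite ltr_wpDr.
have B0 m : 0 < B m by rewrite ltr_wpDr// mulr_ge0// divr_ge0.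
(* Splitting each pole into [p], resp. [q], poles of order [1 / q] pairs the
   [m]-th pole [K m] of the numerator with the [m]-th one of the denominator. *)
have KB m : K m <= B m.
  (* The left side is at most [m], and [m < q + q * (m %/ q)]; then [q <= p]. *)
  have h : (p * (m %/ p) <= p + q * (m %/ q))%N.
    rewrite mulnC (leq_trans (leq_trunc_div _ _))// [X in (X <= _)%N](divn_eq m q).
    by rewrite addnC mulnC leq_add2r (leq_trans (ltnW (ltn_pmod _ _))).
  have {h} : p%:R * (m %/ p)%:R <= p%:R + q%:R * (m %/ q)%:R :> R.
    by rewrite -!natrM -natrD ler_nat.
  rewrite /K /B -(ler_pM2l P0 (1 + _)) => h.
  rewrite [leRHS](_ : _ = p%:R * 2 + q%:R * (m %/ q)%:R); last by field; rewrite lt0r_neq0.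
  lra.
(* The indices below [p q N] cover exactly the first [q N] poles and [p N] zeros. The prefactors of
   the two Gauss products are [(q N) ^ (2 r s)] and [(p N) ^ (b s)]; since [b = 2 r], their quotient
   is [(q / p) ^ (b s)], and [k ^ (b s)] comes from the scale [k]. *)
pose C := (k * (q%:R / p%:R)) `^ b.
apply: (@mellin_fun_lim R (fun N s => C `^ s *
    \prod_(m < p * (q * N)) pole_ratio (K m / 2) (B m / 2) s `^ (q%:R)^-1)).
  move=> N; apply: mellin_funM; first exact/mellin_fun_pow/powR_ge0.
  apply: (@mellin_fun_prod _ (fun m s => pole_ratio (K m / 2) (B m / 2) s `^ (q%:R)^-1)).
  move=> m _; apply: mellin_fun_pole_pow.
  - by rewrite divr_gt0.
  - by rewrite ler_pM2r.
  - by rewrite invr_ge0 ltW//= invf_le1// ler1n.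
move=> s s0; have s20 : 0 <= 2 * s by rewrite mulr_ge0.
have bs0 : 0 <= b * s by rewrite mulr_ge0// ltW.
pose u n : R := \prod_(j < n) ((1 + j%:R) / (1 + j%:R + 2 * s)).
pose v n : R := \prod_(j < n) ((b + j%:R) / (b + j%:R + b * s)).
have u0 n : 0 <= u n by rewrite prodr_ge0// => j _; rewrite divr_ge0// !addr_ge0.
have H1 : ((q * N)%:R `^ (2 * s) * u (q * N)%N) `^ (p%:R / q%:R) @[N --> \oo]
    --> gamma_int 1 (2 * s) `^ (p%:R / q%:R).
  apply: cvg_powR_base.
  - by rewrite ltW// (lt_le_trans ltr01).
  - by apply: nearW => N; rewrite mulr_ge0 ?powR_ge0.
  - have := @gauss_product R 1 ltr01 0 (2 * s) (lexx _) s20.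
    rewrite powR1 mul1r !add0r gamma_int0// invr1 divr1 => H.
    exact: (cvg_comp _ _ (cvg_mulnl q0) H).
have H2 : ((p * N)%:R `^ (b * s) * v (p * N)%N)^-1 @[N --> \oo]
    --> (k `^ (b * s) * gamma_int k (b - 1 + b * s) / gamma_int k (b - 1))^-1.
  apply: cvgV.
    by rewrite !mulf_neq0 ?invr_neq0 ?lt0r_neq0 ?powR_gt0 ?gamma_int_gt0// addr_ge0.
  have := @gauss_product R k k0 (b - 1) (b * s) b1 bs0; rewrite subrK => H.
  exact: (cvg_comp _ _ (cvg_mulnl p0) H).
have kbs : 0 < k `^ (b * s) by rewrite powR_gt0.
have Gb := gamma_int_gt0 k0 b1; have Gbs := gamma_int_gt0 k0 (addr_ge0 b1 bs0).
have H3 : k `^ (b * s) * (((q * N)%:R `^ (2 * s) * u (q * N)%N) `^ (p%:R / q%:R) *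
    ((p * N)%:R `^ (b * s) * v (p * N)%N)^-1) @[N --> \oo] -->
    gamma_int 1 (2 * s) `^ (p%:R / q%:R) * (gamma_int k (b - 1) / gamma_int k (b - 1 + b * s)).
  rewrite [X in _ --> X](_ : _ = k `^ (b * s) * (gamma_int 1 (2 * s) `^ (p%:R / q%:R) *
    (k `^ (b * s) * gamma_int k (b - 1 + b * s) / gamma_int k (b - 1))^-1)).
    by apply: cvgMr; apply: cvgM.
  move: (gamma_int k (b - 1)) (gamma_int k (b - 1 + b * s)) (k `^ (b * s)) (gamma_int 1 _ `^ _) Gb Gbs kbs.
  move=> x y z t x0 y0 z0.
  by field; rewrite !lt0r_neq0.
apply: cvg_trans H3; apply: near_eq_cvg; exists 1%N => // N /= N1.
have N0 : 0 < N%:R :> R by rewrite ltr0n.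
have f0 j : 0 <= (1 + j%:R) / (1 + j%:R + 2 * s) by rewrite divr_ge0// !addr_ge0.
have -> : \prod_(m < p * (q * N)) pole_ratio (K m / 2) (B m / 2) s `^ (q%:R)^-1 =
    u (q * N)%N `^ (p%:R / q%:R) / v (p * N)%N.
  pose F j : R := ((1 + j%:R) / (1 + j%:R + 2 * s)) `^ (q%:R)^-1.
  pose G i : R := ((b + i%:R + b * s) / (b + i%:R)) `^ (q%:R)^-1.
  transitivity (\prod_(m < p * (q * N)) (F (m %/ p)%N * G (m %/ q)%N)).
    apply: eq_bigr => m _; rewrite /F /G -powRM//; last first.
      by rewrite divr_ge0// !addr_ge0// ltW.
    congr (_ `^ _); rewrite /pole_ratio -/(K m).
    have -> : (b + (m %/ q)%:R + b * s) / (b + (m %/ q)%:R) = (B m + 2 * s) / B m.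
      have -> : b + (m %/ q)%:R = B m * (p%:R / q%:R).
        by rewrite /B /b; field; rewrite !lt0r_neq0.
      have := B0 m; move: (B m) => B' B'0; rewrite /b.
      by field; rewrite !lt0r_neq0//.
    have := K0 m; have := B0 m; move: (K m) (B m) => K' B' B'0 K'0.
    by field; rewrite !lt0r_neq0//; lra.
  rewrite big_split/=; congr (_ * _).
    rewrite prod_divn// /u (@powR_prod R _ (fun j => (1 + j%:R) / (1 + j%:R + 2 * s)))//.
    apply: eq_bigr => j _; rewrite /F -powR_mulrn ?powR_ge0// -powRrM.
    by rewrite [p%:R / _]mulrC.
  rewrite mulnCA prod_divn// /v -prodfV; apply: eq_bigr => i _.
  rewrite /G -powR_mulrn ?powR_ge0// -powRrM mulVf ?lt0r_neq0// powRr1 ?invf_div//.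
  by rewrite divr_ge0// !addr_ge0// ltW.
have -> : C `^ s = k `^ (b * s) * (q%:R / p%:R) `^ (b * s).
  by rewrite /C -powRrM powRM// ?ltW// divr_gt0.
rewrite powRM ?powR_ge0// -powRrM !natrM.
rewrite (_ : 2 * s * (p%:R / q%:R) = b * s); last by rewrite /b; ring.
have e0 : 0 < (p%:R * N%:R) `^ (b * s) by rewrite powR_gt0// mulr_gt0.
have -> : (q%:R * N%:R) `^ (b * s) = (q%:R / p%:R) `^ (b * s) * (p%:R * N%:R) `^ (b * s).
  rewrite -powRM ?(ltW (divr_gt0 Q0 P0)) ?(ltW (mulr_gt0 P0 N0))//.
  by congr (_ `^ _); field; rewrite lt0r_neq0.
rewrite invfM; move: ((p%:R * N%:R) `^ (b * s)) e0 => e e0.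
by move: (v _)^-1 => V; field; rewrite lt0r_neq0.
Qed.

Lemma mellin_fun_same_moments (R : realType) (c : R) : 1 < c ->
  exists phi : R -> R, [/\ mellin_fun phi,
    forall n : nat, phi n%:R = gamma_int 1 (2 * n%:R) `^ c &
    phi (1 / 2) != gamma_int 1 (2 * (1 / 2)) `^ c].
Proof.
move=> c1; have c10 : 0 < c - 1 by rewrite subr_gt0.
(* This makes [1 / q < c - 1], hence [1 < r = 1 + 1 / q < c]. *)
pose q := (Num.truncn (c - 1)^-1).+1; pose p := q.+1.
have q0 : 0 < q%:R :> R by rewrite ltr0n.
pose r : R := p%:R / q%:R; pose b := 2 * r.
have rE : r = 1 + q%:R^-1 by rewrite /r -natr1 mulrDl divff ?lt0r_neq0// mul1r.
have r1 : 1 < r by rewrite rE ltrDl invr_gt0.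
have rc : r < c.
  by rewrite rE -ltrBrDl invf_plt ?posrE// truncnS_gt.
pose t := pi / b; have pi0 := @pi_gt0 R.
have b2 : 2 < b by rewrite /b; lra.
have b0 : 0 < b by lra.
have t01 : 0 <= t < pi / 2.
  rewrite divr_ge0 ?(ltW b0) ?pi_ge0//= /t ltr_pM2l//.
  by rewrite ltf_pV2 ?posrE.
have bt : b * t = pi by rewrite /t mulrC divfK// lt0r_neq0.
have k0 : 0 < cos t by apply: cos_gt0_pihalf; case/andP : t01; lra.
have M1 := @mellin_fun_gamma_quotient R (cos t) p q k0 isT (leqnSn q).
have M2 := @mellin_fun_sine R b t (lt_trans (ltr1n R 2) b2) t01 bt.
have cr : 0 <= c - r by rewrite subr_ge0 ltW.
have M3 := mellin_fun_gamma cr.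
have g0 s : 0 <= s -> 0 < gamma_int 1 (2 * s) :> R.
  by move=> s0; apply: gamma_int_gt0 => //; rewrite mulr_ge0.
pose D s := gamma_int 1 (b - 1 + b * s) / gamma_int (cos t) (b - 1 + b * s).
have D0 s : 0 <= s -> 0 < gamma_int (cos t) (b - 1 + b * s) /\ 0 < D s.
  move=> s0; have bs : 0 <= b - 1 + b * s.
    by have : 0 <= b * s; [rewrite mulr_ge0// ltW|lra].
  by split; [|rewrite divr_gt0//]; exact: gamma_int_gt0.
(* The product of the three Mellin functions, whose normalizing constants cancel. At [s = 1 / 2] the
   sine is 1 and [D s > 0], so the value drops strictly. *)
pose phi s := gamma_int 1 (2 * s) `^ c * (1 - D s * sin (pi * s)).
exists phi; split.
- apply: eq_mellin_fun (mellin_funM (mellin_funM M1 M2) M3) => s s0.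
  rewrite -/r -/b /phi.
  have -> : gamma_int 1 (2 * s) `^ c = gamma_int 1 (2 * s) `^ r * gamma_int 1 (2 * s) `^ (c - r).
    by rewrite -powRD ?(gt_eqF (g0 _ s0)) ?implybT// addrC subrK.
  have [Gs _] := D0 _ s0; rewrite /D.
  have Gb : 0 < gamma_int (cos t) (b - 1) by apply: gamma_int_gt0 => //; lra.
  move: (gamma_int _ (b - 1)) (gamma_int (cos t) (b - 1 + b * s)) Gb Gs => x y x0 y0.
  move: (gamma_int 1 (2 * s) `^ r) (gamma_int 1 (2 * s) `^ _) (gamma_int 1 (b - 1 + _)) (sin _) => z w u v.
  by field; rewrite !lt0r_neq0.
- move=> n; rewrite /phi (_ : sin (pi * n%:R) = 0) ?mulr0 ?subr0 ?mulr1//.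
  elim: n => [|n ih]; first by rewrite mulr0 sin0.
  by rewrite -natr1 mulrDr mulr1 sinDpi ih oppr0.
- rewrite /phi mul1r sin_pihalf mulr1.
  have h0 : 0 <= 1 / 2 :> R by [].
  have g := powR_gt0 c (g0 _ h0); have [_ Dh] := D0 _ h0.
  rewrite mul1r in g Dh *.
  by rewrite lt_eqF// gtr_pMr// ltrBlDr ltrDl.
Qed.

(** * Infinite divisibility, determinacy and Mellin transform *)

Theorem theorem4 (R : realType) :
  [/\ infinitely_divisible_stieltjes (fun n : nat => ((2 * n)`!)%:R : R),
      (forall c : R, 0 < c ->
         (stieltjes_determinate (fun n : nat => (((2 * n)`!)%:R : R) `^ c)
          <-> c <= 1)) &
      (forall c : R, 0 < c -> c <= 1 ->
         forall mu : {measure set (measurableTypeR R) -> \bar R},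
           stieltjes_represents mu
             (fun n : nat => (((2 * n)`!)%:R : R) `^ c) ->
           forall s : R, 0 <= s ->
             mellin_transform mu s = (Gamma (2 * s + 1) `^ c)%:E)].
Proof.
pose m (c : R) (n : nat) := (((2 * n)`!)%:R : R) `^ c.
have mE c n : gamma_int 1 (2 * n%:R) `^ c = m c n.
  by rewrite -natrM gamma_int_fact.
have rep (phi : R -> R) c : mellin_fun phi -> (forall n : nat, phi n%:R = m c n) ->
    exists mu : {measure set (measurableTypeR R) -> \bar R}, stieltjes_represents mu (m c) /\
      forall s, 0 <= s -> mellin_transform mu s = (phi s)%:E.
  move=> /mellin_fun_represents[mu [[mu0 mum] muphi]] phim; exists mu; split=> //.
  by split=> // n; rewrite mum phim.
have std c : 0 < c -> exists mu : {measure set (measurableTypeR R) -> \bar R},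
    stieltjes_represents mu (m c) /\
    forall s, 0 <= s -> mellin_transform mu s = (gamma_int 1 (2 * s) `^ c)%:E.
  move=> c0; apply: rep (mellin_fun_gamma (ltW c0)) _ => n; exact: mE.
have eqM (mu nu : {measure set (measurableTypeR R) -> \bar R}) s :
    (forall A : set (measurableTypeR R), measurable A -> mu A = nu A) ->
    mellin_transform mu s = mellin_transform nu s.
  by move=> mn; apply: eq_measure_integral => A mA _; exact: mn.
have uniq c (mu nu : {measure set (measurableTypeR R) -> \bar R}) : 0 < c -> c <= 1 ->
    stieltjes_represents mu (m c) -> stieltjes_represents nu (m c) ->
    forall A : set (measurableTypeR R), measurable A -> mu A = nu A.
  move=> c0 c1; apply: moment_bound_unique => n.
  have f1 : 1 <= (2 * n)`!%:R :> R by rewrite ler1n fact_gt0.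
  by rewrite /m -[leRHS]powRr1 ?(le_trans ler01)// ler_powR.
split.
- split; last by move=> c /std[mu [mum _]]; exists mu.
  have [mu [[mu0 mum] _]] := std 1 ltr01; exists mu; split=> // n.
  by rewrite mum /m powRr1.
- move=> c c0; split=> [[_ u]|c1]; last first.
    split; first by have [mu [mum _]] := std c c0; exists mu.
    by move=> mu nu; exact: uniq.
  rewrite leNgt; apply/negP => c1.
  (* Determinacy would identify the two representing measures, and with them their Mellin transforms
     at [1 / 2]. *)
  have [phi [Mphi phin /eqP]] := mellin_fun_same_moments c1; apply.
  have [mu [mum muM]] := std c c0.
  have [nu [num nuM]] := rep _ c Mphi (fun n => etrans (phin n) (mE c n)).
  have h0 : 0 <= 1 / 2 :> R by [].
  have := eqM _ _ (1 / 2) (u _ _ mum num).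
  by rewrite muM// nuM// => -[].
- move=> c c0 c1 mu mum s s0; have [nu [num nuM]] := std c c0.
  have s20 : 0 <= 2 * s by rewrite mulr_ge0.
  rewrite (Gamma_gamma_int s20) -(nuM s s0).
  exact: (eqM mu nu s (uniq c mu nu c0 c1 mum num)).
Qed.
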